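(* Let $s\ge1$. The Krull--Gabriel dimension of the category $\mathrm{Mod}_{R/\mathfrak{h}_s}$ is $s$.
   Context: Let $k$ be a field, $\mathfrak{S}$ the group of finitary permutations of $\{1,2,\dots\}$, $R=k[x_1,x_2,\dots]$ with $\mathfrak{S}$ permuting variables, $\mathfrak{h}_s$ the ideal generated by all $x_i^{s+1}$. $\mathrm{Mod}_{R/\mathfrak{h}_s}$ is the (locally noetherian Grothendieck) category of $R/\mathfrak{h}_s$-modules with a compatible smooth $\mathfrak{S}$-action (each element fixed by the pointwise stabilizer of some $\{1,\dots,N\}$) and equivariant maps. For a locally noetherian Grothendieck abelian category $\mathcal{A}$, define full subcategories $\mathcal{A}_r$ ($r\ge-1$) inductively: $\mathcal{A}_{-1}=0$, and $\mathcal{A}_r$ consists of the objects whose image in the Serre quotient $\mathcal{A}/\mathcal{A}_{r-1}$ is locally of finite length (a union of finite length subobjects). $\mathcal{A}$ has Krull--Gabriel dimension $r$ if $r$ is minimal with $\mathcal{A}=\mathcal{A}_r$. *)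

(* Defs.v *)
From HB Require Import structures.
From mathcomp Require Import all_boot all_algebra.
Set Implicit Arguments. Unset Strict Implicit. Unset Printing Implicit Defensive.
Import GRing.Theory.
Local Open Scope ring_scope.

(* Finitary permutations of the index set of the variables.  The variables
   x_1, x_2, ... of the paper are indexed here by 0, 1, 2, ... *)
Definition finitary (f : nat -> nat) : Prop :=
  bijective f /\ exists N : nat, forall n, (N <= n)%N -> f n = n.

(* An object of Mod_{R/h_s}: a k-vector space V with commuting linear
   operators x_i (the action of the variables of R = k[x_1,x_2,...]) killed
   by x_i^{s+1}, and a smooth action of the finitary symmetric group by linear
   maps compatible with the R-module structure. *)
Record smooth_mod (k : fieldType) (s : nat) := SMod {
  sm_V : lmodType k;
  sm_x : nat -> sm_V -> sm_V;
  sm_act : (nat -> nat) -> sm_V -> sm_V;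
  sm_x_lin : forall i (a : k) (u v : sm_V),
      sm_x i (a *: u + v) = a *: sm_x i u + sm_x i v;
  sm_x_comm : forall i j (v : sm_V), sm_x i (sm_x j v) = sm_x j (sm_x i v);
  sm_x_nil : forall i (v : sm_V), iter s.+1 (sm_x i) v = 0;
  sm_act_lin : forall f, finitary f -> forall (a : k) (u v : sm_V),
      sm_act f (a *: u + v) = a *: sm_act f u + sm_act f v;
  sm_act_id : forall v : sm_V, sm_act id v = v;
  sm_act_comp : forall f g, finitary f -> finitary g ->
      forall v : sm_V, sm_act (f \o g) v = sm_act f (sm_act g v);
  sm_act_compat : forall f, finitary f -> forall i (v : sm_V),
      sm_act f (sm_x i v) = sm_x (f i) (sm_act f v);
  sm_smooth : forall v : sm_V, exists N : nat, forall f, finitary f ->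
      (forall i, (i < N)%N -> f i = i) -> sm_act f v = v
}.

Section Sub.
Variables (k : fieldType) (s : nat) (M : smooth_mod k s).
Local Notation V := (sm_V M).

Definition is_subobj (P : V -> Prop) : Prop :=
  [/\ P 0,
      forall u v, P u -> P v -> P (u + v),
      forall (a : k) v, P v -> P (a *: v),
      forall i v, P v -> P (@sm_x _ _ M i v)
    & forall f, finitary f -> forall v, P v -> P (@sm_act _ _ M f v)].

Definition incl (P Q : V -> Prop) : Prop := forall v, P v -> Q v.

(* A "class" C is a predicate on subquotients Q/P (P <= Q subobjects of M).
   Simple objects of the Serre quotient by C (subobjects of the image of Q/P
   in the quotient are the images of the Z/P, P <= Z <= Q). *)
Definition simple_mod (C : (V -> Prop) -> (V -> Prop) -> Prop) (P Q : V -> Prop) :=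
  ~ C P Q /\ forall Z, is_subobj Z -> incl P Z -> incl Z Q -> C P Z \/ C Z Q.

Definition fin_length_mod (C : (V -> Prop) -> (V -> Prop) -> Prop) (P Q : V -> Prop) :=
  exists (n : nat) (Y : nat -> V -> Prop),
    [/\ Y 0%N = P, Y n = Q,
        forall j, (j <= n)%N -> is_subobj (Y j)
      & forall j, (j < n)%N -> incl (Y j) (Y j.+1) /\
                   (C (Y j) (Y j.+1) \/ simple_mod C (Y j) (Y j.+1))].

(* Image of Q/P in the Serre quotient by C is locally of finite length:
   it is the union of the images of its subobjects Y/P of finite length in the
   quotient, i.e. Q modulo the sum S of all such Y lies in C. *)
Definition loc_fin_length_mod (C : (V -> Prop) -> (V -> Prop) -> Prop) (P Q : V -> Prop) :=
  let good Y := [/\ is_subobj Y, incl P Y, incl Y Q & fin_length_mod C P Y] in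
  let S := fun v => forall Z, is_subobj Z -> (forall Y, good Y -> incl Y Z) -> Z v in
  C S Q.

(* InA t P Q : the subquotient Q/P belongs to A_{t-1}
   (so InA 0 is the zero class A_{-1}). *)
Fixpoint InA (t : nat) (P Q : V -> Prop) : Prop :=
  match t with
  | 0%N => incl Q P
  | t'.+1 => loc_fin_length_mod (InA t') P Q
  end.

Definition zero_sub : V -> Prop := fun v => v = 0.
Definition full_sub : V -> Prop := fun _ => True.

(* M belongs to A_r (r >= -1), written with t = r + 1. *)
Definition in_A (t : nat) : Prop := InA t zero_sub full_sub.

End Sub.

(* Krull--Gabriel dimension of Mod_{R/h_s} equals r (r >= 0):
   A = A_r and A <> A_{r'} for every -1 <= r' < r. *)
Definition KGdim_eq (k : fieldType) (s r : nat) : Prop :=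
  (forall M : smooth_mod k s, in_A M r.+1) /\
  (forall t : nat, (t < r.+1)%N -> exists M : smooth_mod k s, ~ in_A M t).

(* Main.v *)
From HB Require Import structures.
Require Import Defs.
From mathcomp Require Import all_boot all_algebra.
From mathcomp Require Import zify boolp functions.
Import Defs. (* mathcomp's functions also defines incl *)
Set Implicit Arguments. Unset Strict Implicit. Unset Printing Implicit Defensive.
Import GRing.Theory.
Local Open Scope ring_scope.

(* An object lies in A_{t-1} exactly when each of its elements v is torsion of
   level t: (x_{i_1} ... x_{i_n})^t v = 0 for some distinct indices i_1, ..., i_n
   away from any given finite set.

   Torsion implies membership: filtering cyclic modules reduces to a generator v
   fixed by the permutations of [N, oo), killed by x_i for i < N and by
   x_i^(t+1) for i >= N.  Giving v degree t at each i < N, multiplication of an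
   element by a suitable monomial isolates its part of minimal multidegree, so
   modulo level-t torsion a subobject is determined by a subrepresentation of the
   space of finitely supported functions on N-tuples of distinct indices.  That
   space has finite length over any field: after restricting to the permutations
   fixing a longer initial segment, the top part of a subrepresentation is
   determined by finitely many values (apply prod_j (1 - (t_j z_j)) with fresh
   z_j and move the z_j into the initial segment), and the rest involves fewer
   free indices.

   Membership implies torsion: if v is torsion of level r+1 but not of level r
   for some r > t, then the submodule generated by x_N^r v refutes simplicity,
   again because of multidegrees.

   Finally x_i^(s+1) = 0, so everything is torsion of level s+1, whereas
   1 in R/h_s is not torsion of level s. *)

(** * Finitary permutations and the extension of finite partial injections *)

Definition swap (i j n : nat) : nat :=
  if n == i then j else if n == j then i else n.

Lemma swapK i j : involutive (swap i j).
Proof.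
move=> n; rewrite /swap; case: (eqVneq n i) => [->|ni].
  by rewrite eqxx; case: eqVneq.
case: (eqVneq n j) => [->|nj]; first by rewrite eqxx.
by rewrite (negbTE ni) (negbTE nj).
Qed.

Lemma swap_out i j n : n != i -> n != j -> swap i j n = n.
Proof. by rewrite /swap => /negbTE-> /negbTE->. Qed.

Lemma swapl i j : swap i j i = j. Proof. by rewrite /swap eqxx. Qed.

Lemma finitary_id : finitary id.
Proof. by split; [exists id | exists 0%N]. Qed.

Lemma finitary_swap i j : finitary (swap i j).
Proof.
split; first by exists (swap i j); apply: swapK.
by exists (i + j).+1 => n hn; apply: swap_out; apply/eqP; lia.
Qed.

Lemma finitary_comp f g : finitary f -> finitary g -> finitary (f \o g).
Proof.
move=> [bf [N hN]] [bg [N' hN']]; split; first exact: bij_comp.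
by exists (maxn N N') => n; rewrite geq_max => /andP[h h'] /=; rewrite hN' ?hN.
Qed.

Lemma finitary_inv f : finitary f ->
  exists g, [/\ finitary g, cancel f g & cancel g f].
Proof.
move=> [[g fg gf] [N hN]]; exists g; split=> //.
split; first by exists f.
by exists N => n hn; rewrite -{1}(hN n hn) fg.
Qed.

Lemma finitary_inj f : finitary f -> injective f.
Proof. by move=> [/bij_inj]. Qed.

(** Each transposition corrects the image of one more entry, so duplicate-free lists of equal length
    are matched entrywise, while indices outside both lists stay put. *)
Fixpoint perm_ext (s1 s2 : seq nat) : nat -> nat :=
  match s1, s2 with
  | a :: s1', b :: s2' =>
      let f := perm_ext s1' s2' in swap (f a) b \o f
  | _, _ => id
  end.

Lemma finitary_perm_ext s1 s2 : finitary (perm_ext s1 s2).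
Proof.
elim: s1 s2 => [|a s1 IH] [|b s2] /=; try exact: finitary_id.
exact: finitary_comp (finitary_swap _ _) (IH _).
Qed.

Lemma perm_ext_out s1 s2 n : n \notin s1 -> n \notin s2 -> perm_ext s1 s2 n = n.
Proof.
elim: s1 s2 => [|a s1 IH] [|b s2] //=.
rewrite !inE !negb_or => /andP[na n1] /andP[nb n2].
rewrite IH //; apply: swap_out => //; apply: contra na => /eqP e.
by apply/eqP/(finitary_inj (finitary_perm_ext s1 s2)); rewrite IH.
Qed.

Lemma map_perm_ext s1 s2 : uniq s1 -> uniq s2 -> size s1 = size s2 ->
  map (perm_ext s1 s2) s1 = s2.
Proof.
elim: s1 s2 => [|a s1 IH] [|b s2] //= /andP[a1 u1] /andP[b2 u2] [sz].
rewrite swapl; congr (_ :: _); rewrite -[RHS](IH _ u1 u2 sz).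
apply/eq_in_map => x x1 /=; apply: swap_out.
  apply: contra a1 => /eqP e.
  by rewrite -(finitary_inj (finitary_perm_ext s1 s2) e).
apply: contra b2 => /eqP<-.
by rewrite -[X in _ \in X](IH _ u1 u2 sz) map_f.
Qed.

Lemma perm_fix_geq f a n : finitary f -> (forall i, (i < a)%N -> f i = i) ->
  (a <= f n)%N = (a <= n)%N.
Proof.
move=> ff fa; have [h|h] := ltnP n a; first by rewrite fa // leqNgt h.
have [h'|//] := ltnP (f n) a.
by have := finitary_inj ff (fa _ h') => e; rewrite e ltnNge h in h'.
Qed.

(** * Linearity, commutation and equivariance of monomials acting on a module *)

Section Modules.
Variables (k : fieldType) (s : nat) (M : smooth_mod k s).
Local Notation V := (sm_V M).
Local Notation x := (@sm_x k s M).
Local Notation act := (@sm_act k s M).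
Implicit Types (P Q U Z : V -> Prop) (u v w : V).

Lemma x_add i u v : x i (u + v) = x i u + x i v.
Proof. by have := sm_x_lin i 1 u v; rewrite !scale1r. Qed.

Lemma x_zero i : x i 0 = 0.
Proof. by apply: (addrI (x i 0)); rewrite -x_add !addr0. Qed.

Lemma act_add f u v : finitary f -> act f (u + v) = act f u + act f v.
Proof. by move=> ff; have := sm_act_lin ff 1 u v; rewrite !scale1r. Qed.

Lemma act0 f : finitary f -> act f 0 = 0.
Proof. by move=> ff; apply: (addrI (act f 0)); rewrite -act_add // !addr0. Qed.

Lemma act_scale f a v : finitary f -> act f (a *: v) = a *: act f v.
Proof. by move=> ff; rewrite -[a *: v]addr0 sm_act_lin // act0 // addr0. Qed.

Lemma act_can f g v : finitary f -> finitary g -> cancel f g ->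
  act g (act f v) = v.
Proof.
move=> ff gf fg; rewrite -sm_act_comp //.
by have -> : g \o f = id by [apply/funext => i /=]; rewrite sm_act_id.
Qed.

(** A list encodes a monomial, multiplicities being exponents; the order does not matter by
    [xs_perm]. *)
Definition xs (l : seq nat) (v : V) : V := foldr x v l.

Lemma xs_cat l1 l2 v : xs (l1 ++ l2) v = xs l1 (xs l2 v).
Proof. exact: foldr_cat. Qed.

Lemma xs_add l u v : xs l (u + v) = xs l u + xs l v.
Proof. by elim: l => //= i l ->; rewrite x_add. Qed.

Lemma xs0 l : xs l 0 = 0.
Proof. by elim: l => //= i l ->; rewrite x_zero. Qed.

Lemma xs_scale l a v : xs l (a *: v) = a *: xs l v.
Proof.
elim: l => //= i l ->; rewrite -[a *: _]addr0 sm_x_lin.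
by rewrite -/(x i 0) x_zero addr0.
Qed.

Lemma xs_sum (I : Type) (r : seq I) (F : I -> V) l :
  xs l (\sum_(i <- r) F i) = \sum_(i <- r) xs l (F i).
Proof. by apply: (big_morph (xs l) (xs_add l) (xs0 l)). Qed.

Lemma act_sum (I : Type) (r : seq I) (F : I -> V) f : finitary f ->
  act f (\sum_(i <- r) F i) = \sum_(i <- r) act f (F i).
Proof.
by move=> ff; apply: (big_morph (act f) _ (act0 ff)) => u v; apply: act_add.
Qed.

Lemma xs_perm l1 l2 v : perm_eq l1 l2 -> xs l1 v = xs l2 v.
Proof.
have h i l : xs (rcons l i) v = x i (xs l v).
  by elim: l => //= j l IH; rewrite IH sm_x_comm.
elim: l1 l2 => [|i l1 IH] l2 e.
  by rewrite perm_sym in e; rewrite (perm_nilP e).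
have il2 : i \in l2 by rewrite -(perm_mem e) mem_head.
move: e; case/splitPr: il2 => p1 p2; rewrite perm_sym.
rewrite -cat1s perm_catCA /= perm_cons perm_sym => e.
rewrite /= (IH _ e) xs_cat -/(xs _ _) [RHS]xs_cat /=.
by elim: p1 {e} => //= j p1 <-; rewrite sm_x_comm.
Qed.

Lemma xsC l1 l2 v : xs l1 (xs l2 v) = xs l2 (xs l1 v).
Proof. by rewrite -!xs_cat; apply: xs_perm; rewrite perm_catC. Qed.

Lemma act_xs f l v : finitary f -> act f (xs l v) = xs (map f l) (act f v).
Proof. by move=> ff; elim: l => //= i l <-; rewrite sm_act_compat. Qed.

Lemma xs_nseq_nil i v : xs (nseq s.+1 i) v = 0.
Proof.
rewrite -(sm_x_nil i v); elim: s.+1 => //= n ->.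
by rewrite -iterS iterSr; elim: n => //= m ->.
Qed.

End Modules.

(** * Powers of monomials and their exponents *)

Definition pw (r : nat) (l : seq nat) : seq nat := flatten [seq nseq r i | i <- l].

Lemma pw_cat r l1 l2 : pw r (l1 ++ l2) = pw r l1 ++ pw r l2.
Proof. by rewrite /pw map_cat flatten_cat. Qed.

Lemma pw1 r i : pw r [:: i] = nseq r i.
Proof. by rewrite /pw /= cats0. Qed.

Lemma count_pw r l i : count_mem i (pw r l) = (r * count_mem i l)%N.
Proof.
elim: l => [|j l IH]; first by rewrite muln0.
by rewrite /pw /= count_cat -/(pw r l) IH count_nseq /= mulnDr mulnC.
Qed.

Lemma map_pw f r l : map f (pw r l) = pw r (map f l).
Proof.
by rewrite /pw map_flatten -!map_comp; congr flatten; apply: eq_map => i /=;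
   rewrite map_nseq.
Qed.

Lemma mem_pw r l i : i \in pw r l -> i \in l.
Proof. by case/flattenP => t /mapP[j jl ->] /nseqP[-> _]. Qed.

Lemma perm_count (l1 l2 : seq nat) :
  (forall i, count_mem i l1 = count_mem i l2) -> perm_eq l1 l2.
Proof. by move=> h; apply/allP => i _; apply/eqP. Qed.

Lemma leq_max_seq (l : seq nat) i : i \in l -> (i <= \max_(j <- l) j)%N.
Proof. by move=> il; rewrite (big_rem i il) /= leq_maxl. Qed.

(** * Subobjects, torsion modulo a subobject, and dévissage *)

Section Torsion.
Variables (k : fieldType) (s : nat) (M : smooth_mod k s).
Local Notation V := (sm_V M).
Local Notation x := (@sm_x k s M).
Local Notation act := (@sm_act k s M).
Local Notation xs := (@xs k s M).
Implicit Types (P Q U Z : V -> Prop) (u v w : V) (l : seq nat).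

Definition supported (F : seq nat) (v : V) :=
  forall f, finitary f -> (forall i, i \in F -> f i = i) -> act f v = v.

Lemma smooth_supported v : exists N, supported (iota 0 N) v.
Proof.
have [N hN] := sm_smooth v; exists N => f ff h.
by apply: hN => // i hi; apply: h; rewrite mem_iota.
Qed.

Section Subobj.
Variables (P : V -> Prop) (sP : is_subobj P).

Lemma sub0 : P 0. Proof. by case: sP. Qed.
Lemma subD u v : P u -> P v -> P (u + v). Proof. by case: sP => _ h _ _ _; apply: h. Qed.
Lemma subZ a v : P v -> P (a *: v). Proof. by case: sP => _ _ h _ _; apply: h. Qed.
Lemma subX i v : P v -> P (x i v). Proof. by case: sP => _ _ _ h _; apply: h. Qed.
Lemma subA f v : finitary f -> P v -> P (act f v).
Proof. by case: sP => _ _ _ _ h ff; apply: h. Qed.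
Lemma subN v : P v -> P (- v). Proof. by rewrite -scaleN1r; apply: subZ. Qed.
Lemma subB u v : P u -> P v -> P (u - v).
Proof. by move=> hu hv; apply: subD => //; apply: subN. Qed.
Lemma subXs l v : P v -> P (xs l v).
Proof. by move=> hv; elim: l => //= i l; apply: subX. Qed.
Lemma subS (I : eqType) (r : seq I) (F : I -> V) :
  (forall i, i \in r -> P (F i)) -> P (\sum_(i <- r) F i).
Proof.
move=> h; rewrite big_seq; elim/big_ind: _ => //; first exact: sub0.
exact: subD.
Qed.
Lemma subA_inv f v : finitary f -> P (act f v) -> P v.
Proof.
move=> ff; have [g [gf fg _]] := finitary_inv ff.
by move=> /(subA gf); rewrite act_can.
Qed.
Lemma subDl u v : P u -> P (u + v) -> P v.
Proof. by move=> hu /subB /(_ hu); rewrite addrC addKr. Qed.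

End Subobj.

(** Torsion of level r modulo U. The arbitrary bound B keeps witnesses away from any finite set of
    indices, so that several of them can be multiplied. *)
Definition tor r U u := forall B : nat, exists l,
  [/\ uniq l, all (leq B) l & U (xs (pw r l) u)].

Lemma tor_in r U u : U u -> tor r U u.
Proof. by move=> h B; exists [::]. Qed.

Lemma tor_incl r P Q u : incl P Q -> tor r P u -> tor r Q u.
Proof. by move=> PQ h B; have [l [ul al hl]] := h B; exists l; split=> //; apply: PQ. Qed.

Lemma tor_uniform r U u : is_subobj U -> tor r U u -> exists n B, forall l,
  uniq l -> size l = n -> all (leq B) l -> U (xs (pw r l) u).
Proof.
move=> sU h; have [N hN] := smooth_supported u.
have [l [ul al hl]] := h N; exists (size l), N => l' ul' sl' al'.
have ff := finitary_perm_ext l' l.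
apply: (subA_inv sU ff); rewrite act_xs // map_pw map_perm_ext // hN // => i.
rewrite mem_iota /= add0n => iN; apply: perm_ext_out.
  by apply/negP => /(allP al') /=; rewrite leqNgt iN.
by apply/negP => /(allP al) /=; rewrite leqNgt iN.
Qed.

Lemma tor_leq r r' U u : is_subobj U -> (r <= r')%N -> tor r U u -> tor r' U u.
Proof.
move=> sU rr h B; have [l [ul al hl]] := h B; exists l; split=> //.
rewrite (@xs_perm _ _ _ _ (pw (r' - r) l ++ pw r l)); last first.
  by apply: perm_count => i; rewrite count_cat !count_pw -mulnDl subnK.
by rewrite xs_cat; apply: subXs.
Qed.

(** The second witness is taken beyond all entries of the first, so their concatenation is
    duplicate-free. *)
Lemma tor_trans r U P v :
  (forall u, U u -> tor r P u) -> tor r U v -> tor r P v.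
Proof.
move=> UP h B; have [l [ul al hl]] := h B.
have [l' [ul' al' hl']] := UP _ hl (maxn B (\max_(i <- l) i).+1).
exists (l' ++ l); split; last by rewrite pw_cat xs_cat.
  rewrite cat_uniq ul ul' andbT; apply/hasPn => i il; apply/negP => /(allP al') /=.
  have := leq_max_seq il; lia.
rewrite all_cat al andbT; apply: sub_all al' => i /=; lia.
Qed.

(** By [tor_uniform], two adjacent disjoint blocks of indices serve for a sum, and a block fixed by
    f serves for a translate by f. *)
Lemma tor_subobj r U : is_subobj U -> is_subobj (tor r U).
Proof.
move=> sU; split.
- by apply: tor_in; apply: sub0.
- move=> u v /(tor_uniform sU)[n1 [B1 h1]] /(tor_uniform sU)[n2 [B2 h2]] B.
  pose l1 := iota (B + B1 + B2) n1; pose l2 := iota (B + B1 + B2 + n1) n2.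
  exists (iota (B + B1 + B2) (n1 + n2)); rewrite iota_uniq; split=> //.
    by apply/allP => i; rewrite mem_iota /=; lia.
  rewrite iotaD pw_cat xs_cat !xs_add; apply: subD => //.
    rewrite xsC; apply: subXs => //; apply: h1; rewrite ?iota_uniq ?size_iota //.
    by apply/allP => i; rewrite mem_iota /=; lia.
  apply: subXs => //; apply: h2; rewrite ?iota_uniq ?size_iota //.
  by apply/allP => i; rewrite mem_iota /=; lia.
- move=> a v h B; have [l [ul al hl]] := h B; exists l; split=> //.
  by rewrite xs_scale; apply: subZ.
- move=> i v h B; have [l [ul al hl]] := h B; exists l; split=> //.
  by rewrite -[x i v]/(xs [:: i] v) xsC; apply: subXs.
move=> f ff v /(tor_uniform sU)[n [B1 h]] B; have [_ [N hN]] := ff.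
exists (iota (B + B1 + N) n); rewrite iota_uniq; split=> //.
  by apply/allP => i; rewrite mem_iota /=; lia.
suff e : map f (iota (B + B1 + N) n) = iota (B + B1 + N) n.
  rewrite -e -map_pw -act_xs //; apply: subA => //; apply: h.
  - exact: iota_uniq.
  - exact: size_iota.
  - by apply/allP => i; rewrite mem_iota /=; lia.
rewrite -[RHS]map_id; apply/eq_in_map => i; rewrite mem_iota => hi.
by apply: hN; lia.
Qed.

Definition gen P v : V -> Prop :=
  fun u => forall Z, is_subobj Z -> incl P Z -> Z v -> Z u.

Lemma gen_subobj P v : is_subobj (gen P v).
Proof.
split.
- by move=> Z sZ *; apply: sub0.
- by move=> u w hu hw Z sZ PZ Zv; apply: subD => //; [apply: hu | apply: hw].
- by move=> a w hw Z sZ PZ Zv; apply: subZ => //; apply: hw.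
- by move=> i w hw Z sZ PZ Zv; apply: subX => //; apply: hw.
by move=> f ff w hw Z sZ PZ Zv; apply: subA => //; apply: hw.
Qed.

Lemma gen_incl P v : incl P (gen P v).
Proof. by move=> u Pu Z _ PZ _; apply: PZ. Qed.

Lemma gen_mem P v : gen P v v. Proof. by move=> Z. Qed.

Lemma gen_min P v Z : is_subobj Z -> incl P Z -> Z v -> incl (gen P v) Z.
Proof. by move=> sZ PZ Zv u; apply. Qed.

Inductive term_span P v : V -> Prop :=
| term_span_base u : P u -> term_span P v u
| term_span_step u a l f : term_span P v u -> finitary f ->
    term_span P v (u + a *: xs l (act f v)).

(** The explicit combinations form a subobject containing P and v, and [gen P v] is the least
    one. *)
Lemma gen_span P v u : is_subobj P -> gen P v u -> term_span P v u.
Proof.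
move=> sP; apply.
- have sD u1 u2 : term_span P v u1 -> term_span P v u2 -> term_span P v (u1 + u2).
    move=> h1 h2; elim: h2 => [w Pw|w a l f _ IH ff].
      elim: h1 => [w' Pw'|w' a l f _ IH ff]; first by apply: term_span_base; apply: subD.
      by rewrite addrAC; apply: term_span_step.
    by rewrite addrA; apply: term_span_step.
  split=> //.
  + by apply: term_span_base; apply: sub0.
  + move=> a w; elim=> [w' Pw|w' b l f _ IH ff]; first by apply: term_span_base; apply: subZ.
    by rewrite scalerDr scalerA; apply: term_span_step.
  + move=> i w; elim=> [w' Pw|w' b l f _ IH ff]; first by apply: term_span_base; apply: subX.
    have e : x i (w' + b *: xs l (act f v)) = x i w' + b *: xs (i :: l) (act f v).
      by rewrite -[x i _]/(xs [:: i] _) xs_add xs_scale.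
    by rewrite e; apply: term_span_step.
  + move=> g gf w; elim=> [w' Pw|w' b l f _ IH ff]; first by apply: term_span_base; apply: subA.
    rewrite act_add // act_scale // act_xs // -sm_act_comp //.
    by apply: term_span_step => //; apply: finitary_comp.
- by move=> w; apply: term_span_base.
have := @term_span_step P v 0 1 [::] id (term_span_base v (sub0 sP)) finitary_id.
by rewrite add0r scale1r /= sm_act_id.
Qed.

(* Dévissage: a property of cyclic extensions that holds for the generators
   fixed off [0, N), killed by x_i for i < N and by x_i^(r+1) for i >= N,
   propagates to every (r+1)-torsion generator. *)
Definition core r P N v := [/\ supported (iota 0 N) v,
  forall i, (i < N)%N -> P (x i v) &
  forall i, (N <= i)%N -> P (xs (nseq r.+1 i) v)].

Lemma devissage r (Phi : (V -> Prop) -> V -> Prop) :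
  (forall P v, is_subobj P -> P v -> Phi P v) ->
  (forall P v l, is_subobj P -> Phi P (xs l v) -> Phi (gen P (xs l v)) v ->
     Phi P v) ->
  (forall P N v, is_subobj P -> core r P N v -> Phi P v) ->
  forall P v, is_subobj P -> tor r.+1 P v -> Phi P v.
Proof.
move=> Phi0 PhiS PhiC.
(* Induction on the total exponent of the variables below N. If some exponent exceeds 1, the
   extension by x_i v and the one by v above it both have a smaller total; otherwise [core]
   holds. *)
have step2 K : forall P N v m, is_subobj P -> supported (iota 0 N) v ->
    (forall i, (N <= i)%N -> P (xs (nseq r.+1 i) v)) ->
    (forall i, (i < N)%N -> P (xs (nseq (m i) i) v)) ->
    (\sum_(i <- iota 0 N) m i <= K)%N -> Phi P v.
  elim: K => [|K IH] P N v m sP sv hr hm hK.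
    apply: (PhiC _ N) => //; split=> // i iN.
    have : m i = 0%N.
      have iN' : i \in iota 0 N by rewrite mem_iota.
      by move: hK; rewrite (big_rem i iN') /=; lia.
    by move=> mi; have := hm _ iN; rewrite mi; apply: subX.
  case: (pselect (exists2 i, (i < N)%N & (1 < m i)%N)) => [[i iN mi]|none].
    have iN' : i \in iota 0 N by rewrite mem_iota.
    have upd c : (c < m i)%N ->
        (\sum_(j <- iota 0 N) (if j == i then c else m j) <= K)%N.
      move=> cm; move: hK; rewrite (big_rem i iN') (big_rem i iN') /= eqxx.
      rewrite [X in _ -> (_ + X <= _)%N](eq_big_seq m).
        by move=> h; rewrite -ltnS; apply: leq_trans h; rewrite -addSn leq_add2r.
      by move=> j; rewrite mem_rem_uniq ?iota_uniq // !inE => /andP[/negbTE->].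
    apply: (PhiS _ _ [:: i]) => //.
      apply: (IH _ N _ (fun j => if j == i then (m i).-1 else m j)) => //.
      + move=> f ff hf; rewrite act_xs //= hf // sv //.
      + by move=> j hj; rewrite xsC; apply: subXs => //; apply: hr.
      + move=> j hj; case: eqVneq => [->|_].
          rewrite xsC -xs_cat; have := hm _ iN.
          by case: (m i) mi.
        by rewrite xsC; apply: subXs => //; apply: hm.
      + by apply: upd; lia.
    apply: (IH _ N _ (fun j => if j == i then 1%N else m j)) => //.
    + exact: gen_subobj.
    + by move=> j hj; apply: gen_incl; apply: hr.
    + move=> j hj; case: eqVneq => [->|_]; first exact: gen_mem.
      by apply: gen_incl; apply: hm.
    + exact: upd.
  apply: (PhiC _ N) => //; split=> // i iN.
  have : (m i <= 1)%N by rewrite leqNgt; apply/negP => h; apply: none; exists i.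
  have := hm _ iN; case: (m i) => [|[|//]] /= h _ //.
  exact: subX.
(* Induction on the list, with w = x_i^(r+1) v. The extension by w needs only the shorter list;
   above w, transposing i with any j outside F puts x_j^(r+1) v in [gen P w], and [step2] takes
   over. *)
have step1 : forall l P F v, is_subobj P -> supported F v -> uniq l ->
    ~~ has (mem F) l -> P (xs (pw r.+1 l) v) -> Phi P v.
  elim=> [|i l IH] P F v sP sv /=; first by move=> *; apply: Phi0.
  move=> /andP[il ul]; rewrite negb_or => /andP[iF lF] hl.
  set w := xs (nseq r.+1 i) v.
  have gi j : j \notin F -> gen P w (xs (nseq r.+1 j) v).
    move=> jF; have ff := finitary_swap i j.
    have {1}<- : act (swap i j) v = v.
      by apply: sv => // n nF; apply: swap_out; apply: contraTneq nF => ->.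
    rewrite -{1}(swapl i j) -map_nseq -act_xs //.
    by apply: (subA (gen_subobj P w) ff); apply: gen_mem.
  apply: (PhiS _ _ (nseq r.+1 i)) => //.
    apply: (IH _ (i :: F)) => //.
    - move=> f ff hf; rewrite act_xs // map_nseq hf ?mem_head // sv // => n nF.
      by apply: hf; rewrite inE nF orbT.
    - apply/hasPn => n nl; rewrite !inE negb_or.
      by rewrite (contraNneq _ il) ?(hasPn lF) // => <-.
    - by rewrite xsC -xs_cat.
  pose N := (\max_(n <- F) n).+1.
  have FN n : n \in F -> (n < N)%N by move=> nF; rewrite ltnS; apply: leq_max_seq.
  (* The exponents s+1 come from the nilpotence of the variables. *)
  apply: (step2 _ _ N _ (fun=> s.+1)) => //.
  - exact: gen_subobj.
  - by move=> f ff hf; apply: sv => // n /FN nN; apply: hf; rewrite mem_iota.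
  - by move=> n nN; apply: gi; apply/negP => /FN; rewrite ltnNge nN.
  - by move=> n _; rewrite xs_nseq_nil; apply: sub0; apply: gen_subobj.
move=> P v sP tv; have [N hN] := smooth_supported v.
have [l [ul al hl]] := tv N; apply: (step1 l P (iota 0 N)) => //.
apply/hasPn => i /(allP al) /=; rewrite mem_iota /=; lia.
Qed.

End Torsion.

(** * Multidegrees in the extension of P by a core generator *)

Definition mono (F : nat -> nat) (t : seq nat) := flatten [seq nseq (F i) i | i <- t].

Lemma count_mono F t i : uniq t ->
  count_mem i (mono F t) = (if i \in t then F i else 0)%N.
Proof.
elim: t => [|j t IH] //= /andP[jt ut].
rewrite /mono /= count_cat -/(mono F t) IH // count_nseq in_cons /=.
have [->|ij] := eqVneq i j; first by rewrite (negbTE jt) addn0 mul1n.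
by [].
Qed.

Section Core.
Variables (k : fieldType) (s : nat) (M : smooth_mod k s).
Local Notation V := (sm_V M).
Local Notation x := (@sm_x k s M).
Local Notation act := (@sm_act k s M).
Local Notation xs := (@xs k s M).
Variables (P : V -> Prop) (r N : nat) (v : V).
Hypotheses (sP : is_subobj P) (cv : core r P N v).

Lemma xs_kill m i l w : (m <= count_mem i l)%N -> P (xs (nseq m i) w) -> P (xs l w).
Proof.
move=> hm hP.
rewrite (@xs_perm _ _ _ _
  (filter (predC1 i) l ++ nseq (count_mem i l - m) i ++ nseq m i)).
  by rewrite !xs_cat; apply: (subXs sP); apply: (subXs sP).
apply: perm_count => j; rewrite !count_cat !count_nseq /= count_filter.
have [->|ji] := eqVneq j i.
  rewrite !mul1n subnK // (@eq_count _ (predI (pred1 i) (predC1 i)) pred0) ?count_pred0 // => n /=.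
  by case: eqP.
rewrite !mul0n !addn0; apply: eq_count => n /=.
by case: eqP => //= ->; rewrite ji.
Qed.

Definition is_tup (b : seq nat) := uniq b && (size b == N).

(** Since v is fixed by the stabilizer of [0, N), a translate of v depends only on the images b of
    0, ..., N-1; the chosen extension of this map is immaterial. *)
Definition vb (b : seq nat) : V := act (perm_ext (iota 0 N) b) v.

Lemma act_vb f b : finitary f -> is_tup b -> act f (vb b) = vb (map f b).
Proof.
move=> ff /andP[ub /eqP sb].
have [ffx ffb] := (finitary_perm_ext (iota 0 N) b, finitary_perm_ext (iota 0 N) (map f b)).
have [g [gf fg gfK]] := finitary_inv ffb.
have umap : uniq (map f b) by rewrite map_inj_uniq //; apply: finitary_inj.
rewrite /vb -sm_act_comp //; set h := perm_ext _ (map f b).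
have [sv _ _] := cv; rewrite -(act_can (act _ v) gf ffb gfK); congr (act h _).
rewrite -sm_act_comp //; last exact: finitary_comp.
apply: sv => [|i iN]; first by apply: finitary_comp => //; apply: finitary_comp.
rewrite /= -[RHS]fg; congr g; rewrite -/h.
have : map (f \o perm_ext (iota 0 N) b) (iota 0 N) = map h (iota 0 N).
  by rewrite map_comp !map_perm_ext ?iota_uniq ?size_map ?size_iota.
by move/eq_in_map; apply.
Qed.

Lemma vb_iota : vb (iota 0 N) = v.
Proof.
have [sv _ _] := cv; apply: sv => [|i iN]; first exact: finitary_perm_ext.
have := map_perm_ext (iota_uniq 0 N) (iota_uniq 0 N) erefl.
by rewrite -[RHS]map_id => /eq_in_map; apply.
Qed.

Lemma act_v f : finitary f -> act f v = vb (map f (iota 0 N)).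
Proof.
by move=> ff; rewrite -{1}vb_iota act_vb // /is_tup iota_uniq size_iota eqxx.
Qed.

Lemma vb_in b i : is_tup b -> i \in b -> P (x i (vb b)).
Proof.
move=> /andP[ub /eqP sb] ib; have ff := finitary_perm_ext (iota 0 N) b.
move: ib; rewrite -{1}(map_perm_ext (iota_uniq 0 N) ub); last by rewrite size_iota.
move=> /mapP[j jN ->]; rewrite -sm_act_compat //; apply: subA => //.
by case: cv => _ h _; apply: h; rewrite mem_iota in jN.
Qed.

Lemma vb_pow b i : is_tup b -> P (xs (nseq r.+1 i) (vb b)).
Proof.
move=> tb; case ib: (i \in b).
  by apply: (@xs_kill 1 i); rewrite ?count_nseq /= ?eqxx //; apply: vb_in.
have /andP[ub /eqP sb] := tb; have ff := finitary_perm_ext (iota 0 N) b.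
have [g [gf fg gfK]] := finitary_inv ff.
rewrite -(gfK i) -map_nseq -act_xs //; apply: subA => //.
case: cv => _ _ h; apply: h; rewrite leqNgt; apply/negP => hi; move/negP: ib; apply.
rewrite -(map_perm_ext (iota_uniq 0 N) ub) ?size_iota // -[i]gfK.
by apply: map_f; rewrite mem_iota.
Qed.

(* The vector [xs l (vb b)] is multigraded of this degree once [vb b] is given
   degree r at each i in b. *)
Definition deg (b l : seq nat) (i : nat) : nat :=
  if i \in b then r else count_mem i l.

(** The terms that may survive modulo P: all others lie in P by [bad_in]. *)
Definition good (b l : seq nat) :=
  ~~ has (mem l) b && all (fun i => count_mem i l <= r)%N l.

Lemma bad_in b l : is_tup b -> ~~ good b l -> P (xs l (vb b)).
Proof.
move=> tb; rewrite negb_and negbK => /orP[/hasP[i ib /= il]|/allPn[i _]].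
  by apply: (@xs_kill 1 i); [rewrite -has_count has_pred1 | apply: vb_in].
by rewrite -ltnNge => h; apply: (@xs_kill r.+1 i) => //; apply: vb_pow.
Qed.

(** The complementary monomial, which raises a good term (b, l) to degree r at every index below
    n. *)
Definition topup n b l := mono (fun i => r - deg b l i)%N (iota 0 n).

Lemma count_topup n b l i :
  count_mem i (topup n b l) = (if i < n then r - deg b l i else 0)%N.
Proof. by rewrite count_mono ?iota_uniq // mem_iota. Qed.

(** The degree at i becomes too high: if i is in b, a factor x_i is present and sends [vb b] into P;
    otherwise the exponent of x_i exceeds r. *)
Lemma topup_kill n b0 l0 b l i : is_tup b -> (i < n)%N ->
  (deg b0 l0 i < deg b l i)%N -> P (xs (topup n b0 l0 ++ l) (vb b)).
Proof.
move=> tb iN; rewrite {2}/deg; case ib: (i \in b) => h.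
  apply: (@xs_kill 1 i); last exact: vb_in.
  by rewrite count_cat count_topup iN; lia.
apply: (@xs_kill r.+1 i); last exact: vb_pow.
rewrite count_cat count_topup iN; lia.
Qed.

(** What a good term on b in variables below n becomes once raised to degree r below n; only b is
    remembered. *)
Definition yv n b := xs (pw r [seq i <- iota 0 n | i \notin b]) (vb b).

Lemma count_compl n (b : seq nat) i : count_mem i [seq j <- iota 0 n | j \notin b] =
  ((i < n)%N && (i \notin b)).
Proof. by rewrite count_uniq_mem ?filter_uniq ?iota_uniq // mem_filter mem_iota andbC. Qed.

Lemma topup_top n b0 l0 b l : good b l -> all (gtn n) l ->
  (forall i, (i < n)%N -> deg b l i = deg b0 l0 i) ->
  xs (topup n b0 l0 ++ l) (vb b) = yv n b.
Proof.
move=> /andP[/hasPn gb /allP gl] /allP ln e; apply: xs_perm; apply: perm_count => i.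
rewrite count_cat count_topup count_pw count_compl.
have [iN|iN] := ltnP i n; last first.
  by rewrite muln0; apply/count_memPn/negP => /ln /=; rewrite ltnNge iN.
rewrite -e // /deg; case ib: (i \in b) => /=.
  by rewrite subnn muln0; apply/count_memPn; apply: (gb _ ib).
rewrite muln1 subnK //; case il: (i \in l); first exact: gl.
by have /count_memPn -> := negbT il.
Qed.

Lemma yv_step n m b : (n <= m)%N -> all (gtn n) b ->
  yv m b = xs (pw r (iota n (m - n))) (yv n b).
Proof.
move=> nm /allP hb; rewrite /yv -xs_cat -pw_cat; apply: xs_perm; apply: perm_count => i.
rewrite !count_pw count_cat !count_compl count_uniq_mem ?iota_uniq // mem_iota.
congr (_ * _)%N; case ib: (i \in b) => /=.
  have /= := hb _ ib; lia.
lia.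
Qed.

Lemma act_yv f n b : finitary f -> (forall i, (n <= i)%N -> f i = i) -> is_tup b ->
  act f (yv n b) = yv n (map f b).
Proof.
move=> ff fn tb; rewrite /yv act_xs // act_vb // map_pw; apply: xs_perm.
apply: perm_count => i; rewrite !count_pw; congr (_ * _)%N.
have [g [gf fg gfK]] := finitary_inv ff.
have gn j : (n <= j)%N -> g j = j by move=> h; rewrite -{1}(fn j h) fg.
rewrite count_compl count_map -[i in RHS]gfK mem_map; last exact: finitary_inj.
rewrite (@eq_count _ _ (pred1 (g i))); last first.
  by move=> j /=; rewrite -[i in LHS]gfK inj_eq //; apply: finitary_inj.
rewrite count_compl; congr (_ && _); rewrite gfK.
have [h|h] := ltnP i n; last by rewrite gn // ltnNge h.
by rewrite ltnNge; apply/negP => /[dup] h' /fn; rewrite gfK => e; rewrite -e leqNgt h in h'.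
Qed.

End Core.

(** * Membership in the filtration implies torsion *)

Section Necessity.
Variables (k : fieldType) (s : nat) (M : smooth_mod k s).
Local Notation V := (sm_V M).
Local Notation x := (@sm_x k s M).
Local Notation act := (@sm_act k s M).
Local Notation xs := (@xs k s M).
Implicit Types (P Q U Z : V -> Prop) (u v w : V) (l : seq nat).

(** Multiples of translates of x_N^r v have degree at least r at N+1 indices, whereas the given
    power applied to v has degree r only at indices below N, and at most t < r elsewhere. Its
    complement therefore sends it, as an element of the submodule, into P, and the result is a
    product of r-th powers applied to v. *)
Lemma core_not_in_power t r P N v l0 : is_subobj P -> core r P N v -> (t < r)%N ->
  uniq l0 -> all (leq N) l0 -> gen P (xs (nseq r N) v) (xs (pw t l0) v) ->
  tor r P v.
Proof.
move=> sP cv tr ul0 /allP al0 /(gen_span sP) hspan.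
pose b0 := iota 0 N.
have tb0 : is_tup N b0 by rewrite /is_tup iota_uniq size_iota eqxx.
have l0b i : (i < N)%N -> i \notin l0.
  by move=> iN; apply/negP => /al0 /=; rewrite leqNgt iN.
have [n0 h0] : exists n0, forall n, (n0 <= n)%N ->
    P (xs (topup r n b0 (pw t l0)) (xs (pw t l0) v)).
  elim: hspan => [u Pu|u a l f _ [n0 IH] ff].
    by exists 0%N => n _; apply: subXs.
  (* Pigeonhole: f is injective on N+1 indices, and only N values lie below N. *)
  have [j jN fj] : exists2 j, (j <= N)%N & (N <= f j)%N.
    apply: contrapT => h.
    have : {subset map f (iota 0 N.+1) <= iota 0 N}.
      move=> i /mapP[j]; rewrite mem_iota add0n ltnS => jN ->.
      by rewrite mem_iota /= add0n ltnNge; apply/negP => Nf; apply: h; exists j.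
    move/(uniq_leq_size _); rewrite map_inj_uniq ?iota_uniq; last exact: finitary_inj.
    by move=> /(_ isT); rewrite size_map !size_iota ltnn.
  exists (n0 + (f j).+1)%N => n hn; rewrite xs_add; apply: (subD sP); first by apply: IH; lia.
  rewrite xs_scale; apply: (subZ sP).
  rewrite act_xs // (act_v cv) // map_nseq -!xs_cat -?catA.
  apply: (topup_kill sP cv (i := f j)); last 1 first.
  - have -> : deg r b0 (pw t l0) (f j) = (t * count_mem (f j) l0)%N.
      by rewrite /deg mem_iota /= add0n ltnNge fj /= count_pw.
    apply: (@leq_ltn_trans t); first by rewrite count_uniq_mem //; case: (_ \in _); lia.
    rewrite /deg; case: ifP => // /negbT fjb; apply: leq_trans tr _.
    rewrite count_cat count_nseq /=.
    have -> : j = N.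
      apply/eqP; rewrite eqn_leq jN leqNgt; apply: contra fjb => jN'.
      by apply: map_f; rewrite mem_iota.
    by rewrite eqxx mul1n leq_addl.
  - rewrite /is_tup size_map size_iota eqxx map_inj_uniq ?iota_uniq //.
    exact: finitary_inj.
  - lia.
pose n := (n0 + N + (\max_(i <- pw t l0) i).+1)%N.
have : P (yv r N v n b0).
  rewrite -(topup_top N v (b0 := b0) (l0 := pw t l0) (l := pw t l0)) //.
  - by rewrite xs_cat (vb_iota cv); apply: h0; rewrite /n; lia.
  - apply/andP; split.
      apply/hasPn => i; rewrite mem_iota => iN /=.
      by apply/negP => /mem_pw; apply/negP/l0b.
    apply/allP => i _; rewrite count_pw count_uniq_mem //; case: (_ \in _); lia.
  - by apply/allP => i /leq_max_seq /=; rewrite /n; lia.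
rewrite /yv (vb_iota cv).
have -> : [seq i <- iota 0 n | i \notin b0] = iota N (n - N).
  have -> : n = (N + (n - N))%N by rewrite /n; lia.
  rewrite iotaD filter_cat add0n addKn -[RHS]cat0s; congr (_ ++ _).
    by apply/eqP; rewrite -[_ == _]negbK -has_filter -all_predC; apply/allP => i /= ->.
  by apply/all_filterP/allP => i; rewrite !mem_iota; lia.
(* The indices N, ..., n-1 are moved beyond B by a permutation that fixes v. *)
move=> hP B; pose l := iota (maxn B N) (n - N).
have ul : uniq l by apply: iota_uniq.
exists l; split=> //; first by apply/allP => i; rewrite mem_iota /=; lia.
have ff := finitary_perm_ext l (iota N (n - N)).
have [sv _ _] := cv.
apply: (subA_inv sP ff); rewrite act_xs // map_pw map_perm_ext ?iota_uniq ?size_iota //.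
rewrite sv // => i; rewrite mem_iota => iN; apply: perm_ext_out; rewrite mem_iota; lia.
Qed.

(** Dévissage reduces to a core generator v, and simplicity is tested on the submodule generated by
    w = x_N^r v. If it is negligible, w is r-torsion, and moving N to an index beyond B shows that v
    is too; if the quotient by it is negligible, [core_not_in_power] applies. *)
Lemma simple_tor_step t r P Q v : is_subobj P -> is_subobj Q ->
  (forall Z, is_subobj Z -> incl P Z -> incl Z Q ->
     (forall u, Z u -> tor t P u) \/ (forall u, Q u -> tor t Z u)) ->
  (t < r)%N -> incl P Q -> Q v -> tor r.+1 P v -> tor r P v.
Proof.
move=> sP sQ simp tr PQ Qv tv.
pose Phi P' v := incl P P' -> incl P' Q -> Q v -> tor r P' v.
suff : Phi P v by apply.
apply: devissage tv => // {v Qv}.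
- by move=> P' v _ P'v _ _ _; apply: tor_in.
- move=> P' v l sP' h1 h2 PP' P'Q Qv.
  have Qw : Q (xs l v) by apply: subXs.
  have g1 : incl (gen P' (xs l v)) (tor r P').
    apply: gen_min; [exact: tor_subobj | by move=> u; apply: tor_in | exact: h1].
  apply: (tor_trans g1); apply: h2 => //.
    by move=> u /PP'; apply: gen_incl.
  exact: gen_min.
move=> P' N v sP' cv PP' P'Q Qv.
set w := xs (nseq r N) v.
have Qw : Q w by apply: subXs.
have [||h|h] := simp (gen P' w) (gen_subobj _ _).
- by move=> u /PP'; apply: gen_incl.
- exact: gen_min.
- have tw : tor r P' w.
    apply: (@tor_leq _ _ _ t) => //; first exact: ltnW.
    by apply: (tor_incl PP'); apply: h; apply: gen_mem.
  move=> B; pose i := maxn B N.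
  have ff := finitary_swap N i.
  have [_ _ _ _ /(_ _ ff _ tw)] := tor_subobj r sP'.
  have [sv _ _] := cv.
  rewrite act_xs // map_nseq swapl sv //; last first.
    by move=> n; rewrite mem_iota => nN; apply: swap_out; rewrite /i; apply/eqP; lia.
  move=> /(_ (maxn B i.+1))[l [ul al hl]]; exists (l ++ [:: i]); split.
  + rewrite cat_uniq ul /= orbF andbT; apply/negP => /(allP al) /=; lia.
  + rewrite all_cat /= andbT; apply/andP; split; last by rewrite /i; lia.
    by apply: sub_all al => n /=; lia.
  + by rewrite pw_cat xs_cat pw1.
have [l0 [ul0 al0 hl0]] := h _ Qv N.
exact: core_not_in_power hl0.
Qed.

Lemma tor_top P v : is_subobj P -> tor s.+1 P v.
Proof.
move=> sP B; exists [:: B]; split; rewrite ?all_seq1 //.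
by rewrite pw1 xs_nseq_nil; apply: sub0.
Qed.

(** Nilpotence gives level s+1, and [simple_tor_step] lowers the level by one as long as it exceeds
    t+1. *)
Lemma simple_tor t P Q v : is_subobj P -> is_subobj Q ->
  (forall Z, is_subobj Z -> incl P Z -> incl Z Q ->
     (forall u, Z u -> tor t P u) \/ (forall u, Q u -> tor t Z u)) ->
  incl P Q -> Q v -> tor t.+1 P v.
Proof.
move=> sP sQ simp PQ Qv; have := tor_top v sP.
have : exists d, (s.+1 <= t.+1 + d)%N by exists s; lia.
move=> [d]; elim: d s.+1 => [|d IH] r hr tv.
  by apply: tor_leq tv; rewrite // -[t.+1]addn0.
have [h|h] := leqP r (t.+1 + d); first exact: IH tv.
apply: (IH r.-1); first lia.
case: r h hr tv => // r h hr tv /=.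
by apply: (simple_tor_step sP sQ simp _ PQ Qv tv); lia.
Qed.

Lemma loc_fin_length_sum_subobj (C : (V -> Prop) -> (V -> Prop) -> Prop) P Q :
  is_subobj (fun v => forall Z, is_subobj Z ->
    (forall Y, [/\ is_subobj Y, incl P Y, incl Y Q & fin_length_mod C P Y] ->
       incl Y Z) -> Z v).
Proof.
split.
- by move=> Z sZ _; apply: sub0.
- by move=> u v hu hv Z sZ h; apply: subD => //; [apply: hu | apply: hv].
- by move=> a v hv Z sZ h; apply: subZ => //; apply: hv.
- by move=> i v hv Z sZ h; apply: subX => //; apply: hv.
by move=> f ff v hv Z sZ h; apply: subA => //; apply: hv.
Qed.

(** In a chain of finite length, negligible steps are torsion of level t by induction, and simple
    ones of level t+1. Torsion elements form a subobject, so the sum S is torsion; the quotient by S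
    is torsion by induction. *)
Lemma InA_tor t P Q : is_subobj P -> is_subobj Q -> incl P Q ->
  InA t P Q -> forall v, Q v -> tor t P v.
Proof.
elim: t P Q => [|t IH] P Q sP sQ PQ; first by move=> h v /h; apply: tor_in.
rewrite /= /loc_fin_length_mod; set S := fun v => _ => h v Qv.
have sS : is_subobj S by apply: loc_fin_length_sum_subobj.
have SQ : incl S Q by move=> u; apply=> // Y [].
apply: (@tor_trans _ _ _ _ S); last by apply: (@tor_leq _ _ _ t) => //; apply: IH h _ Qv.
move=> {v Qv} u; apply; first exact: tor_subobj.
move=> Y [sY _ _ [n [W [W0 Wn sW hW]]]]; rewrite -Wn.
have : (n <= n)%N by [].
elim: {-2}n => [|j IHj] jn v; first by rewrite W0; apply: tor_in.
have [inc st] := hW j jn.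
have [sWj sWj'] := (sW j (ltnW jn), sW j.+1 jn).
move=> Wv; apply: (tor_trans (IHj (ltnW jn))).
case: st => [/IH H|[_ simp]].
  by apply: (@tor_leq _ _ _ t) => //; apply: H.
apply: simple_tor Wv => // Z sZ jZ Zj.
by case: (simp Z sZ jZ Zj) => H; [left | right] => w; apply: IH H w.
Qed.

End Necessity.

(** * Bounds on the number of essential steps in a chain *)

(* At most L steps of an increasing chain in C violate R; when R W W' says that
   W' / W is negligible, this bounds the length of C modulo negligible pieces. *)
Definition chain_bound (T : Type) (C : (T -> Prop) -> Prop)
    (R : (T -> Prop) -> (T -> Prop) -> Prop) (L : nat) :=
  forall W : nat -> T -> Prop,
    (forall i, C (W i)) -> (forall i c, W i c -> W i.+1 c) ->
    forall t : seq nat, uniq t -> (forall i, i \in t -> ~ R (W i) (W i.+1)) ->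
    (size t <= L)%N.

(** A step that violates R violates R1 or R2, so the bounds add up. *)
Lemma chain_bound_and (T : Type) (C : (T -> Prop) -> Prop)
    (R1 R2 R : (T -> Prop) -> (T -> Prop) -> Prop) L1 L2 :
  chain_bound C R1 L1 -> chain_bound C R2 L2 ->
  (forall W W', C W -> C W' -> (forall c, W c -> W' c) ->
     R1 W W' -> R2 W W' -> R W W') ->
  chain_bound C R (L1 + L2).
Proof.
move=> h1 h2 hR W CW mW t ut ht.
pose p1 i := `[< ~ R1 (W i) (W i.+1) >]; pose p2 i := `[< ~ R2 (W i) (W i.+1) >].
apply: (@leq_trans (count p1 t + count p2 t)).
  rewrite -count_predUI -[X in (X <= _)%N](@eqP _ _ _ (_ : count (predU p1 p2) t == size t)).
    exact: leq_addr.
  rewrite -all_count; apply/allP => i it /=; apply/orP.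
  case: (pselect (R1 (W i) (W i.+1))) => r1; last by left; apply/asboolP.
  case: (pselect (R2 (W i) (W i.+1))) => r2; last by right; apply/asboolP.
  by case: (ht i it); apply: hR => //; apply: mW.
rewrite -!size_filter; apply: leq_add.
  by apply: (h1 W) => //; [apply: filter_uniq|move=> i; rewrite mem_filter => /andP[/asboolP]].
by apply: (h2 W) => //; [apply: filter_uniq|move=> i; rewrite mem_filter => /andP[/asboolP]].
Qed.

Lemma chain_bound_map (T T' : Type) (phi : (T -> Prop) -> T' -> Prop)
    (C : (T -> Prop) -> Prop) (C' : (T' -> Prop) -> Prop)
    (R : (T -> Prop) -> (T -> Prop) -> Prop)
    (R' : (T' -> Prop) -> (T' -> Prop) -> Prop) L :
  (forall W, C W -> C' (phi W)) ->
  (forall W W' c, (forall c, W c -> W' c) -> phi W c -> phi W' c) ->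
  (forall W W', C W -> C W' -> (forall c, W c -> W' c) ->
     R' (phi W) (phi W') -> R W W') ->
  chain_bound C' R' L -> chain_bound C R L.
Proof.
move=> hC hm hR h W CW mW t ut ht; apply: (h (fun i => phi (W i))) => //.
- by move=> i; apply: hC.
- by move=> i c; apply: hm; apply: mW.
by move=> i it r'; apply: (ht i it); apply: hR => //; apply: mW.
Qed.

(** * Finite length of the space of functions on tuples of distinct indices *)

Section Tuples.
Variables (k : fieldType) (N : nat).
Local Notation F := (seq nat -> k).
Implicit Types (c : F) (W : F -> Prop) (b t z X : seq nat).

(* Finitely supported functions on N-tuples of distinct indices, at most d of
   which are >= a and hence movable by the perms fixing [0, a). *)
Record tuple_rep (d a : nat) (W : F -> Prop) : Prop := {
  rep0 : W (fun=> 0);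
  repD : forall c c', W c -> W c' -> W (fun b => c b + c' b);
  repZ : forall (e : k) c, W c -> W (fun b => e * c b);
  repA : forall f c, finitary f -> (forall i, (i < a)%N -> f i = i) -> W c ->
    W (fun b => c (map f b));
  repS : forall c, W c -> exists T : seq (seq nat), forall b, c b != 0 ->
    [/\ b \in T, uniq b, size b = N & (count (leq a) b <= d)%N] }.

Lemma repB d a W c c' : tuple_rep d a W -> W c -> W c' -> W (fun b => c b - c' b).
Proof.
move=> rW Wc Wc'; have := repD rW Wc (repZ rW (-1) Wc').
by congr W; apply/funext => b; rewrite mulN1r.
Qed.

(** For W inside W' this is equality of the restrictions to S, hence equality of W and W' when S is
    everything. *)
Definition agree (S : pred (seq nat)) W W' : Prop :=
  forall c', W' c' -> exists2 c, W c & forall b, S b -> c b = c' b.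

(** The values at p of the functions vanishing on X form a subspace of k, which can grow only
    once. *)
Lemma chain_bound_point d a (X : seq (seq nat)) (p : seq nat) :
  chain_bound (tuple_rep d a)
    (fun W W' => forall c', W' c' -> (forall b, b \in X -> c' b = 0) ->
       exists c, [/\ W c, (forall b, b \in X -> c b = 0) & c p = c' p]) 1.
Proof.
move=> W rW mW t ut ht.
have mon i j c : (i <= j)%N -> W i c -> W j c.
  by move=> /subnKC <-; elim: (j - i)%N => [|n IH]; rewrite ?addn0 // addnS => /IH/mW.
have once i j : i \in t -> j \in t -> (i < j)%N -> False.
  move=> it jt ij; apply: (ht j jt) => c' _ _.
  case: (pselect (exists c, [/\ W i.+1 c, (forall b, b \in X -> c b = 0) & c p != 0])).
    move=> [c [Wc cX cp]]; exists (fun b => (c' p / c p) * c b); split.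
    - by apply: repZ => //; apply: (mon i.+1).
    - by move=> b /cX ->; rewrite mulr0.
    - by rewrite divfK.
  move=> none; case: (ht i it) => c Wc cX.
  have [cp|cp] := eqVneq (c p) 0; last by case: none; exists c.
  by exists (fun=> 0); split=> //; apply: (rep0 (rW i)).
case: t ut once {ht} => [|i [|j t]] //= /andP[]; rewrite inE negb_or => /andP[ij _] _ once.
case: (ltngtP i j) ij => // h _.
  by case: (once i j); rewrite ?inE ?eqxx ?orbT.
by case: (once j i); rewrite ?inE ?eqxx ?orbT.
Qed.

(** A dimension count, one point at a time: after matching the values on X, the remaining difference
    vanishes on X and is corrected at p. *)
Lemma chain_bound_finite d a (X : seq (seq nat)) :
  chain_bound (tuple_rep d a) (agree (mem X)) (size X).
Proof.
elim: X => [|p X IH] /=.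
  move=> W rW mW [|i t] // _ /(_ i (mem_head _ _)) []; move=> c' _.
  by exists (fun=> 0) => //; apply: (rep0 (rW i)).
rewrite -addn1; apply: (chain_bound_and IH (@chain_bound_point d a X p)).
move=> W W' rW rW' WW' h1 h2 c' Wc'.
have [c Wc e] := h1 c' Wc'.
have [||c2 [Wc2 e2 ep]] := h2 (fun b => c' b - c b).
- exact: (repB rW' Wc' (WW' _ Wc)).
- by move=> b bX; rewrite e // subrr.
exists (fun b => c b + c2 b); first exact: (repD rW).
move=> b /=; rewrite inE => /orP[/eqP->|bX]; first by rewrite ep addrC subrK.
by rewrite e2 // e // addr0.
Qed.

(* The operator prod_j (1 - (t_j z_j)) with fresh z: on tuples avoiding z it
   cuts a function down to the tuples that contain t. *)
Lemma cut_out d a W w t z : tuple_rep d a W -> W w -> size t = size z ->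
  uniq (t ++ z) -> all (leq a) (t ++ z) ->
  (forall b, has (mem z) b -> w b = 0) ->
  exists2 w', W w' & forall b, ~~ has (mem z) b ->
    w' b = if all (mem b) t then w b else 0.
Proof.
move=> rW Ww; elim: t z => [|p t IH] [|q z] //=; first by move=> *; exists w.
rewrite mem_cat inE !negb_or cat_uniq /= negb_or.
move=> [sz] /and4P[/and3P[pt pq pz] ut /andP[qt tz] /andP[qz uz]].
rewrite all_cat /= => /and4P[ap at_ aq az] fresh.
have [|||w' Ww' hw'] := IH z sz.
- by rewrite cat_uniq ut uz tz.
- by rewrite all_cat at_.
- move=> b /hasP[i ib iz]; apply: fresh; apply/hasP; exists i => //.
  by rewrite /= inE (iz : i \in z) orbT.
exists (fun b => w' b - w' (map (swap p q) b)).
  apply: (repB rW) => //; apply: (repA rW) => //; first exact: finitary_swap.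
  by move=> i ia; apply: swap_out; apply/eqP => e; move: ap aq; rewrite -e /=; lia.
move=> b bz.
have qb : q \notin b by apply: contra bz => qb; apply/hasP; exists q; rewrite //= mem_head.
have bz' : ~~ has (mem z) b.
  by apply: contra bz => /hasP[i ib iz]; apply/hasP; exists i; rewrite //= inE (iz : i \in z) orbT.
rewrite (hw' b) //; have [pb|pb] /= := boolP (p \in b); last first.
  have -> : map (swap p q) b = b.
    rewrite -[RHS]map_id; apply/eq_in_map => i ib.
    by apply: swap_out; apply: contraTneq ib => ->.
  by rewrite hw' // subrr.
rewrite hw'.
  rewrite (fresh (map _ b)); first by rewrite if_same subr0.
  by apply/hasP; exists q; rewrite /= ?mem_head // -{1}(swapl p q) map_f.
apply/hasPn => _ /mapP[i ib ->] /=; rewrite /swap.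
case: eqP => [_|_]; first exact: qz.
case: eqP => [_|_]; first exact: pz.
exact: (hasPn bz').
Qed.

Definition words (K n : nat) : seq (seq nat) :=
  iter n (fun ws => [seq i :: w | i <- iota 0 K, w <- ws]) [:: [::]].

Lemma mem_words K b : all (gtn K) b -> b \in words K (size b).
Proof.
elim: b => //= i b IH /andP[iK bK]; apply/allpairsP; exists (i, b).
by rewrite mem_iota; split=> //; apply: IH.
Qed.

(** The set of entries at least a, sorted so that equal sets give equal lists. *)
Definition key (a : nat) b := sort leq (filter (leq a) b).

(** Finitely many values suffice for every tau: tau is exchanged for the block t0 = [a', a'+d),
    where [agree] provides a member of W; [cut_out] retains the tuples containing t0, and a second
    permutation returns to tau. *)
Lemma agree_key d a W W' c' tau : let a' := (a + d)%N in
  tuple_rep d a W -> tuple_rep d a W' ->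
  agree (mem (words (a' + d) N)) W W' -> W' c' ->
  uniq tau -> sorted leq tau -> size tau = d -> all (leq a') tau ->
  exists2 w, W w & forall b, count (leq a') b = d ->
    w b = if key a' b == tau then c' b else 0.
Proof.
move=> a' rW rW' J Wc' utau stau sz atau.
pose t0 := iota a' d.
have ut0 : uniq t0 by apply: iota_uniq.
have st0 : size t0 = d by apply: size_iota.
have at0 : all (leq a') t0 by apply/allP => i; rewrite mem_iota => /andP[].
have outl (s1 : seq nat) i : all (leq a) s1 -> (i < a)%N -> i \notin s1.
  by move=> al ia; apply/negP => /(allP al) /=; rewrite leqNgt ia.
have aa' : (a <= a')%N by apply: leq_addr.
have lift s1 : all (leq a') s1 -> all (leq a) s1.
  by apply: sub_all => i; apply: leq_trans.
have ff1 := finitary_perm_ext t0 tau; set f1 := perm_ext t0 tau in ff1 *.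
have mf1 : map f1 t0 = tau by apply: map_perm_ext; rewrite ?sz.
have f1a i : (i < a)%N -> f1 i = i.
  by move=> ia; apply: perm_ext_out; apply: outl ia; apply: lift.
have [w0 Ww0 e0] := J _ (repA rW' ff1 f1a Wc').
have [T hT] := repS rW Ww0.
(* Z exceeds every index in the support of w0, so w0 vanishes on tuples meeting z. *)
pose Z := (a' + d + (\max_(i <- flatten T) i).+1)%N.
pose z := iota Z d.
have hz : all (leq Z) z by apply/allP => i; rewrite mem_iota => /andP[].
have utz : uniq (t0 ++ z).
  rewrite cat_uniq ut0 iota_uniq andbT; apply/hasPn => i /=.
  by rewrite !mem_iota /Z; lia.
have atz : all (leq a) (t0 ++ z).
  rewrite all_cat lift //=; apply: lift; apply: sub_all hz => i /=; rewrite /Z; lia.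
have fresh b : has (mem z) b -> w0 b = 0.
  move=> /hasP[i ib /= iz]; apply/eqP; apply/negPn/negP => /hT[bT _ _ _].
  have /leq_max_seq : i \in flatten T by apply/flattenP; exists b.
  by move: iz; rewrite mem_iota /Z; lia.
have szz : size t0 = size z by rewrite !size_iota.
have [w1 Ww1 hw1] := cut_out rW Ww0 szz utz atz fresh.
(* Besides carrying tau to t0, f2 carries [a, a') to z. A tuple with d entries from a' on and at
   most d from a on has none in [a, a'), so its image avoids z. *)
pose src := tau ++ iota a d.
have ff2 := finitary_perm_ext src (t0 ++ z).
set f2 := perm_ext src _ in ff2 *.
have usrc : uniq src.
  rewrite cat_uniq utau iota_uniq andbT; apply/hasPn => i; rewrite mem_iota => hi /=.
  by apply/negP => /(allP atau) /=; rewrite /a'; lia.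
have : map f2 src = t0 ++ z.
  by apply: map_perm_ext => //; rewrite !size_cat !size_iota sz.
rewrite map_cat => /eqP; rewrite eqseq_cat ?size_map ?sz // => /andP[/eqP m1 /eqP m2].
have f2a i : (i < a)%N -> f2 i = i.
  move=> ia; apply: perm_ext_out; apply: outl ia => //.
  by rewrite all_cat lift //=; apply/allP => j; rewrite mem_iota => /andP[].
have if2 := finitary_inj ff2.
have f12 i : i \in tau -> f1 (f2 i) = i.
  move=> it; have : map (f1 \o f2) tau = map id tau by rewrite map_comp m1 map_id.
  by move/eq_in_map; apply.
exists (fun b => w1 (map f2 b)); first exact: (repA rW).
move=> b cb.
have [T2 hT2] := repS rW (repA rW ff2 f2a Ww1).
have [T' hT'] := repS rW' Wc'.
have [[ub sb cab]|bad] :=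
  pselect [/\ uniq b, size b = N & (count (leq a) b <= d)%N]; last first.
  have -> : c' b = 0 by apply/eqP/negPn/negP => /hT'[*]; apply: bad.
  by rewrite if_same; apply/eqP/negPn/negP => /hT2[*]; apply: bad.
have mid i : i \in b -> (a <= i)%N -> (a' <= i)%N.
  move=> ib ai; rewrite leqNgt; apply/negP => ia'.
  have := count_predC (leq a') (filter (leq a) b).
  rewrite size_filter count_filter (@eq_count _ _ (leq a')); last first.
    by move=> n /=; rewrite andb_idr // => /(leq_trans aa').
  rewrite cb => e; move: cab; rewrite -e leqNgt -[X in (X < _)%N]addn0 ltn_add2l.
  rewrite -has_count => /hasPn /(_ i); rewrite mem_filter ai ib => /(_ isT) /=.
  by rewrite negbK leqNgt ia'.
have nz : ~~ has (mem z) (map f2 b).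
  apply/hasPn => _ /mapP[i ib ->] /=; rewrite -m2 mem_map //.
  by apply/negP; rewrite mem_iota => /andP[/(mid _ ib) h1]; rewrite ltnNge h1.
have sf : size (filter (leq a') b) = d by rewrite size_filter.
have mkey i : key a' b = tau -> i \in b -> (a' <= i)%N -> i \in tau.
  by move=> <- ib ai; rewrite mem_sort mem_filter ai.
have -> : w1 (map f2 b) = if key a' b == tau then w0 (map f2 b) else 0.
  rewrite hw1 //; congr (if _ then _ else _); apply/allP/eqP => [h|h i].
    have sub : {subset tau <= filter (leq a') b}.
      move=> i it; rewrite mem_filter (allP atau) //= -(mem_map if2).
      by apply: h; rewrite -m1 map_f.
    have [_ e] := uniq_min_size utau sub (eq_leq (etrans sf (esym sz))).
    rewrite -[RHS](sorted_sort leq_trans stau).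
    apply/(perm_sortP leq_total leq_trans anti_leq).
    by rewrite perm_sym; apply: uniq_perm => //; apply: filter_uniq.
  rewrite -m1 => /mapP[n]; rewrite -h mem_sort mem_filter => /andP[_ nb] ->.
  exact: map_f.
case: eqP => // kb; rewrite e0; last first.
  rewrite /= -sb -(size_map f2); apply: mem_words; apply/allP => _ /mapP[i ib ->] /=.
  have [ia|ia] := ltnP i a; first by rewrite f2a //; apply: leq_trans ia _; lia.
  have : f2 i \in t0 by rewrite -m1 map_f // mkey // mid.
  by rewrite mem_iota => /andP[].
congr c'; rewrite -map_comp -[RHS]map_id; apply/eq_in_map => i ib /=.
have [ia|ia] := ltnP i a; first by rewrite f2a // f1a.
by rewrite f12 // mkey // mid.
Qed.

(** The support of c' is finite, so finitely many keys occur, and the functions given by [agree_key]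
    for them add up to the required one. *)
Lemma agree_top d a W W' : let a' := (a + d)%N in
  tuple_rep d a W -> tuple_rep d a W' ->
  agree (mem (words (a' + d) N)) W W' ->
  agree (fun b => count (leq a') b == d) W W'.
Proof.
move=> a' rW rW' J c' Wc'.
have [T hT] := repS rW' Wc'.
pose ks := [seq key a' b | b <- T & uniq b && (count (leq a') b == d)].
suff [w Ww hw] : exists2 w, W w & forall b, count (leq a') b = d ->
    w b = if key a' b \in ks then c' b else 0.
  exists w => // b /eqP cb; rewrite hw //; case: ifP => // /negP h.
  apply/esym/eqP/negPn/negP => /hT[bT ub _ _]; apply: h.
  by apply: map_f; rewrite mem_filter ub cb eqxx.
have : {in ks, forall tau,
    [/\ uniq tau, sorted leq tau, size tau = d & all (leq a') tau]}.
  move=> tau /mapP[b]; rewrite mem_filter => /andP[/andP[ub /eqP cb] _] ->.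
  rewrite /key sort_uniq filter_uniq // sort_sorted; last exact: leq_total.
  by rewrite size_sort size_filter cb; split=> //; rewrite all_sort filter_all.
elim: ks => [|tau ks IH] h.
  by exists (fun=> 0) => //; apply: (rep0 rW).
have [|w Ww hw] := IH; first by move=> x xk; apply: h; rewrite inE xk orbT.
have [tk|tk] := boolP (tau \in ks).
  by exists w => // b cb; rewrite hw // inE; case: eqP => //= ->; rewrite tk.
have [utau stau sz atau] := h tau (mem_head _ _).
have [w' Ww' hw'] := agree_key rW rW' J Wc' utau stau sz atau.
exists (fun b => w b + w' b); first exact: (repD rW).
move=> b cb; rewrite hw // hw' // inE; case: eqP => [->|_] /=; last by rewrite addr0.
by rewrite (negbTE tk) add0r.
Qed.

(** Induction on d. For d = 0 the supports lie in a fixed finite set. Otherwise the part on tuples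
    with d+1 entries from a' on is controlled by finitely many values, and functions vanishing there
    involve at most d such entries, so they fall under the induction for the permutations fixing [0,
    a'). *)
Lemma chain_bound_tuples d a :
  exists L, chain_bound (tuple_rep d a) (agree predT) L.
Proof.
elim: d a => [|d IH] a.
  exists (size (words a N) + 0)%N.
  apply: (chain_bound_and (R2 := fun _ _ => True)
            (@chain_bound_finite 0 a (words a N))) => //.
    by move=> W _ _ [|i t] // _ /(_ i (mem_head _ _)) [].
  move=> W W' rW rW' WW' h _ c' Wc'; have [c Wc e] := h c' Wc'; exists c => // b _.
  have [bX|bX] := boolP (b \in words a N); first exact: e.
  have z V c1 : tuple_rep 0 a V -> V c1 -> c1 b = 0.
    move=> rV Vc1; have [T hT] := repS rV Vc1.
    apply/eqP/negPn/negP => /hT[_ _ sb]; rewrite leqn0 -leqn0 leqNgt -has_count => h0.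
    move/negP: bX; apply; rewrite -sb; apply: mem_words; apply/allP => i ib /=.
    by rewrite ltnNge; apply: (hasPn h0).
  by rewrite (z W) // (z W').
pose a' := (a + d.+1)%N.
have [L hL] := IH a'.
pose top b := count (leq a') b == d.+1.
pose low W c := W c /\ forall b, top b -> c b = 0.
exists (size (words (a' + d.+1) N) + L)%N.
apply: (chain_bound_and (R2 := fun W W' => agree predT (low W) (low W'))
          (@chain_bound_finite d.+1 a (words (a' + d.+1) N))).
  apply: (chain_bound_map (phi := low)) hL => //; last first.
    by move=> W W' c WW' [/WW' Wc hc].
  move=> W rW; split.
  - by split=> //; apply: (rep0 rW).
  - move=> c c' [Wc hc] [Wc' hc']; split; first exact: (repD rW).
    by move=> b tb; rewrite hc // hc' // addr0.
  - move=> e c [Wc hc]; split; first exact: (repZ rW).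
    by move=> b tb; rewrite hc // mulr0.
  - move=> f c ff fa [Wc hc]; split.
      by apply: (repA rW) => // i ia; apply: fa; apply: leq_trans ia _; apply: leq_addr.
    move=> b tb; apply: hc; rewrite /top count_map -(eqP tb); apply/eqP.
    by apply: eq_count => i /=; apply: perm_fix_geq.
  move=> c [Wc hc]; have [T hT] := repS rW Wc; exists T => b cb.
  have [bT ub sb cab] := hT b cb; split=> //.
  have : count (leq a') b != d.+1 by apply: contra cb => tb; rewrite hc.
  have : (count (leq a') b <= count (leq a) b)%N.
    by apply: sub_count => i; apply: leq_trans; apply: leq_addr.
  by move: cab; lia.
move=> W W' rW rW' WW' J hlow c' Wc'.
have [c Wc e] := agree_top rW rW' J Wc'.
have [|c1 [Wc1 _] e1] := hlow (fun b => c' b - c b).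
  split; first exact: (repB rW' Wc' (WW' _ Wc)).
  by move=> b tb; rewrite e // subrr.
exists (fun b => c b + c1 b); first exact: (repD rW).
by move=> b _; rewrite e1 // addrC subrK.
Qed.

End Tuples.

(** * Bounded chains between P and [gen P v] for a core generator v *)

Lemma eq_sum_support (k : fieldType) (V : lmodType k) (I : eqType) (c : I -> k)
    (F : I -> V) (T T' : seq I) : uniq T -> uniq T' ->
  (forall i, c i != 0 -> i \in T) -> (forall i, c i != 0 -> i \in T') ->
  \sum_(i <- T) c i *: F i = \sum_(i <- T') c i *: F i.
Proof.
move=> uT uT' hT hT'.
have red (X : seq I) : \sum_(i <- X) c i *: F i = \sum_(i <- X | c i != 0) c i *: F i.
  rewrite [LHS](bigID (fun i => c i != 0)) /= [X in _ + X]big1 ?addr0 // => i.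
  by rewrite negbK => /eqP->; rewrite scale0r.
rewrite red [RHS]red -big_filter -[RHS]big_filter; apply: perm_big.
apply: uniq_perm; rewrite ?filter_uniq // => i; rewrite !mem_filter.
by case: eqVneq => //= ci; rewrite hT // hT'.
Qed.

Section CoreBound.
Variables (k : fieldType) (s : nat) (M : smooth_mod k s).
Local Notation V := (sm_V M).
Local Notation act := (@sm_act k s M).
Local Notation xs := (@xs k s M).
Variables (P : V -> Prop) (r N : nat) (v : V).
Hypotheses (sP : is_subobj P) (cv : core r P N v).
Implicit Types (U : V -> Prop) (c : seq nat -> k).
Local Notation vb := (vb N v).
Local Notation yv := (yv r N v).

(** The coefficients of top multidegree occurring in U. Only large n is required because a
    permutation is compatible with [yv n] once it fixes all indices from n on. *)
Definition top_coefs U c := exists T : seq (seq nat),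
  [/\ uniq T, forall b, c b != 0 -> b \in T, forall b, b \in T -> is_tup N b
    & exists n0, forall n, (n0 <= n)%N -> U (\sum_(b <- T) c b *: yv n b)].

Lemma top_coefs_sum U c T : top_coefs U c -> uniq T ->
  (forall b, c b != 0 -> b \in T) ->
  exists n0, forall n, (n0 <= n)%N -> U (\sum_(b <- T) c b *: yv n b).
Proof.
move=> [T' [uT' hT' _ [n0 h]]] uT hT; exists n0 => n /h.
by rewrite (eq_sum_support _ uT' uT).
Qed.

Lemma top_coefs_rep U : is_subobj U -> tuple_rep N N 0 (top_coefs U).
Proof.
move=> sU; split.
- exists [::]; split=> // [b|]; first by rewrite eqxx.
  by exists 0%N => n _; rewrite big_nil; apply: sub0.
- move=> c c' Wc Wc'.
  have [T [uT hT tT _]] := Wc; have [T' [uT' hT' tT' _]] := Wc'.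
  have uTT : uniq (undup (T ++ T')) by apply: undup_uniq.
  have [|n h] := top_coefs_sum Wc uTT.
    by move=> b /hT; rewrite mem_undup mem_cat => ->.
  have [|n' h'] := top_coefs_sum Wc' uTT.
    by move=> b /hT'; rewrite mem_undup mem_cat orbC => ->.
  exists (undup (T ++ T')); split=> //.
  + move=> b; rewrite mem_undup mem_cat => hb; apply/orP.
    have [c0|/hT] := eqVneq (c b) 0; last by left.
    by right; apply: hT'; rewrite c0 add0r in hb.
  + by move=> b; rewrite mem_undup mem_cat => /orP[/tT|/tT'].
  exists (n + n')%N => m hm.
  rewrite (eq_bigr _ (fun b _ => scalerDl _ _ _)) big_split.
  by apply: (subD sU); [apply: h | apply: h']; lia.
- move=> e c [T [uT hT tT [n h]]]; exists T; split=> //.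
    by move=> b; rewrite mulf_eq0 negb_or => /andP[_ /hT].
  exists n => m /h hm; rewrite (eq_bigr _ (fun b _ => esym (scalerA _ _ _))).
  by rewrite -scaler_sumr; apply: subZ.
- move=> f c ff _ [T [uT hT tT [n h]]].
  have [g [gf fg gfK]] := finitary_inv ff.
  have [_ [B hB]] := ff.
  have mfg : cancel (map f) (map g).
    by move=> b; rewrite -map_comp -[RHS]map_id; apply: eq_map => i /=.
  have mgf : cancel (map g) (map f).
    by move=> b; rewrite -map_comp -[RHS]map_id; apply: eq_map => i /=.
  exists (map (map g) T); split.
  + by rewrite map_inj_uniq //; apply: can_inj mgf.
  + by move=> b /hT bT; rewrite -[b]mfg map_f.
  + move=> _ /mapP[b bT ->]; have /andP[ub sb] := tT b bT.
    by rewrite /is_tup size_map sb map_inj_uniq ?ub //; apply: finitary_inj.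
  exists (n + B)%N => m hm; apply: (subA_inv sU ff); rewrite act_sum // big_map.
  rewrite (eq_big_seq (fun b => c b *: yv m b)); first by apply: h; lia.
  move=> b bT; rewrite act_scale // mgf (act_yv cv) // ?mgf //.
  + by move=> i im; apply: hB; lia.
  + have /andP[ub sb] := tT b bT.
    by rewrite /is_tup size_map sb map_inj_uniq ?ub //; apply: finitary_inj.
move=> c [T [uT hT tT _]]; exists T => b /hT bT.
have /andP[ub /eqP sb] := tT b bT; split=> //; rewrite -[X in (_ <= X)%N]sb.
exact: count_size.
Qed.

Lemma top_coefs_incl U U' c : incl U U' -> top_coefs U c -> top_coefs U' c.
Proof.
move=> UU' [T [uT hT tT [n h]]]; exists T; split=> //.
by exists n => m /h; apply: UU'.
Qed.

(* A term (a, (b, l)) stands for a *: xs l (vb b). *)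
Local Notation term := (k * (seq nat * seq nat))%type.
Definition tval (t : term) : V := t.1 *: xs t.2.2 (vb t.2.1).

Lemma gen_terms u : gen P v u -> exists2 T : seq term,
  all (fun t => is_tup N t.2.1) T & P (u - \sum_(t <- T) tval t).
Proof.
move=> /(gen_span sP); elim=> {u} [u Pu|u a l f _ [T tT hT] ff].
  by exists [::]; rewrite // big_nil subr0.
exists ((a, (map f (iota 0 N), l)) :: T).
  rewrite /= tT andbT /is_tup size_map size_iota eqxx andbT.
  by rewrite map_inj_uniq ?iota_uniq //; apply: finitary_inj.
by rewrite big_cons /tval /= (act_v cv ff) addrKA.
Qed.

Lemma exists_minn (I : eqType) (h : I -> nat) (T : seq I) : T != [::] ->
  exists2 t0, t0 \in T & forall t, t \in T -> (h t0 <= h t)%N.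
Proof.
elim: T => // t [|t' T] IH _; first by exists t; rewrite ?mem_head // => t'; rewrite inE => /eqP->.
have [//|t0 t0T ht0] := IH.
have [hle|hlt] := leqP (h t0) (h t).
  exists t0; first by rewrite inE t0T orbT.
  by move=> t1; rewrite inE => /orP[/eqP->|/ht0].
exists t; first exact: mem_head.
move=> t1; rewrite inE => /orP[/eqP->//|/ht0]; apply: leq_trans; exact: ltnW.
Qed.

Lemma sum_collect (T : seq term) (F : seq nat -> V) :
  \sum_(t <- T) t.1 *: F t.2.1 =
  \sum_(b <- undup [seq t.2.1 | t <- T]) (\sum_(t <- T | t.2.1 == b) t.1) *: F b.
Proof.
rewrite [RHS](eq_bigr (fun b => \sum_(t <- T | t.2.1 == b) t.1 *: F b)); last first.
  by move=> b _; rewrite scaler_suml.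
rewrite (exchange_big_dep predT) //=; apply: eq_big_seq => t tT.
rewrite (eq_bigl (pred1 t.2.1)); last by move=> b /=; rewrite eq_sym.
by rewrite -big_filter filter_pred1_uniq ?undup_uniq ?big_seq1 // mem_undup;
   apply: (map_f (fun t : term => t.2.1)).
Qed.

Section Reflect.
Variables (U U' : V -> Prop).
Hypotheses (sU : is_subobj U) (sU' : is_subobj U') (PU : incl P U) (UU' : incl U U').
Hypothesis WU : forall c, top_coefs U' c -> top_coefs U c.

(* Multiplying by the complement of a term of minimal degree kills all terms of
   other multidegrees, so the minimal part has coefficients in top_coefs U'. *)
Lemma tor_terms m (T : seq term) : (size T <= m)%N ->
  all (fun t => is_tup N t.2.1) T -> U' (\sum_(t <- T) tval t) ->
  tor r U (\sum_(t <- T) tval t).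
Proof.
elim: m T => [|m IH] T sz tT hT.
  by move: sz; rewrite leqn0 => /nilP->; rewrite big_nil; apply: tor_in (sub0 sU).
have [/hasP[t tin bad]|/hasPn nobad] :=
  boolP (has (fun t => ~~ good r t.2.1 t.2.2) T).
  have Pt : P (tval t) by apply: subZ => //; apply: bad_in bad => //; apply: (allP tT).
  move: hT; rewrite (big_rem t tin) /= => hT; apply: (subD (tor_subobj r sU)).
    by apply: tor_in; apply: PU.
  apply: IH; first by rewrite size_rem //; move: sz; case: (size T).
    by apply/allP => t' /mem_rem /(allP tT).
  by apply: (subDl sU') hT; apply/UU'/PU.
have [->|Tn] := eqVneq T [::]; first by rewrite big_nil; apply: tor_in (sub0 sU).
have [n bnd] : exists n, forall t i, t \in T -> i \in t.2.1 ++ t.2.2 -> (i < n)%N.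
  exists (\max_(i <- flatten [seq t.2.1 ++ t.2.2 | t <- T]) i).+1 => t i tin it.
  rewrite ltnS; apply: leq_max_seq; apply/flattenP.
  by exists (t.2.1 ++ t.2.2) => //; apply: (map_f (fun t : term => t.2.1 ++ t.2.2)).
have bndb t i : t \in T -> i \in t.2.1 -> (i < n)%N.
  by move=> tin it; apply: (bnd t) => //; rewrite mem_cat it.
have bndl t i : t \in T -> i \in t.2.2 -> (i < n)%N.
  by move=> tin it; apply: (bnd t) => //; rewrite mem_cat it orbT.
pose dg (t : term) i := deg r t.2.1 t.2.2 i.
(* As t0 has minimal total degree, any term of another multidegree exceeds it at some index, and
   [topup_kill] applies with the complement of t0. *)
have [t0 t0T t0min] :=
  exists_minn (fun t => (\sum_(i <- iota 0 n) dg t i)%N) Tn.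
pose same t := all (fun i => dg t i == dg t0 i) (iota 0 n).
have sameP t i : same t -> (i < n)%N -> dg t i = dg t0 i.
  by move=> /allP h iN; apply/eqP/h; rewrite mem_iota.
have diffP t : t \in T -> ~~ same t -> exists2 i, (i < n)%N & (dg t0 i < dg t i)%N.
  move=> tin /allPn[j jn ne]; apply: contrapT => none.
  have le i : i \in iota 0 n -> (dg t i <= dg t0 i)%N.
    by rewrite mem_iota => iN; rewrite leqNgt; apply/negP => h; apply: none; exists i.
  have := t0min t tin; rewrite (big_rem j jn) (big_rem j jn) /= leqNgt => /negP; apply.
  rewrite -addSn; apply: leq_add; first by rewrite ltn_neqAle ne le.
  by rewrite big_seq [X in (_ <= X)%N]big_seq; apply: leq_sum => i /mem_rem/le.
pose T1 := filter same T; pose T2 := filter (predC same) T.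
have T1T t : t \in T1 -> t \in T /\ same t by rewrite mem_filter => /andP[].
have T2T t : t \in T2 -> t \in T /\ ~~ same t by rewrite mem_filter => /andP[].
have tupT t : t \in T -> is_tup N t.2.1 by move/(allP tT).
have goodT t : t \in T -> good r t.2.1 t.2.2 by move/nobad; rewrite negbK.
have split_T : \sum_(t <- T) tval t = \sum_(t <- T1) tval t + \sum_(t <- T2) tval t.
  by rewrite /T1 /T2 !big_filter (bigID same).
have U1 : U' (\sum_(t <- T1) t.1 *: yv n t.2.1).
  have low : U' (xs (topup r n t0.2.1 t0.2.2) (\sum_(t <- T2) tval t)).
    rewrite xs_sum; apply: (subS sU') => t /T2T[tin ne].
    have [i iN lt] := diffP t tin ne.
    rewrite /tval xs_scale -xs_cat; apply: UU'; apply: PU; apply: (subZ sP).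
    by apply: (topup_kill sP cv (i := i)) => //; apply: tupT.
  have := subXs sU' (topup r n t0.2.1 t0.2.2) hT.
  rewrite split_T addrC xs_add => /(subDl sU' low); rewrite xs_sum.
  rewrite (eq_big_seq (fun t => t.1 *: yv n t.2.1)) //.
  move=> t /T1T[tin st]; rewrite /tval xs_scale -xs_cat topup_top //.
  - exact: goodT.
  - by apply/allP => i; apply: bndl.
  - by move=> i; apply: sameP.
pose c1 b := \sum_(t <- T1 | t.2.1 == b) t.1.
pose Tl := undup [seq t.2.1 | t <- T1].
have uTl : uniq Tl by apply: undup_uniq.
have Tl_tup b : b \in Tl -> is_tup N b /\ all (gtn n) b.
  rewrite mem_undup => /mapP[t /T1T[tin _] ->]; split; first exact: tupT.
  by apply/allP => i; apply: bndb.
have c1Tl b : c1 b != 0 -> b \in Tl.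
  apply: contraNT => bT; rewrite /c1 big_seq_cond big1 // => t /andP[tin /eqP e].
  by move: bT; rewrite mem_undup -e (map_f (fun t : term => t.2.1)).
(* The minimal part has coefficients in [top_coefs U'], hence by [WU] in [top_coefs U]. *)
have [|n1 h1] := top_coefs_sum (WU (c := c1) _) uTl c1Tl.
  exists Tl; split=> // [b /Tl_tup[] //|]; exists n => n' nn'.
  move: U1; rewrite (sum_collect _ (yv n)) -/Tl => /(subXs sU' (pw r (iota n (n' - n)))).
  rewrite xs_sum; congr U'; apply: eq_big_seq => b /Tl_tup[_ bn].
  by rewrite xs_scale -yv_step.
pose n' := maxn n n1.
have nn' : (n <= n')%N by apply: leq_maxl.
have U2 : U (\sum_(t <- T1) t.1 *: yv n' t.2.1).
  by rewrite sum_collect; apply: h1; apply: leq_maxr.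
(* [Bs] collects the indices where the common degree of T1 is already r, among them all tuple
   entries. The other indices H below n' are traded for fresh ones G: multiplied by x_G^r, each term
   of T1 becomes the monomial lR times a vector that f carries to a multiple of [yv n']. *)
move=> B; pose K := maxn B n.
pose Bs i := (i < n)%N && (dg t0 i == r).
pose H := [seq i <- iota 0 n' | ~~ Bs i].
pose G := iota K (size H).
have uH : uniq H by rewrite filter_uniq ?iota_uniq.
have uG : uniq G by apply: iota_uniq.
have GK i : i \in G -> (K <= i)%N by rewrite mem_iota => /andP[].
have ff := finitary_perm_ext G H; set f := perm_ext G H in ff *.
have fB i : Bs i -> f i = i.
  move=> bi; apply: perm_ext_out; last by rewrite mem_filter bi.
  by apply/negP => /GK; case/andP: bi => iN _; rewrite /K; lia.
have tB t i : t \in T1 -> i \in t.2.1 -> Bs i.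
  move=> /T1T[tin st] ib; have iN := bndb t i tin ib.
  by rewrite /Bs iN -(sameP t) // /dg /deg ib eqxx.
pose lR := mono (dg t0) [seq i <- iota 0 n | ~~ Bs i].
pose Bm (t : term) := [seq i <- iota 0 n | Bs i && (i \notin t.2.1)].
pose inner (t : term) := t.1 *: xs (pw r (G ++ Bm t)) (vb t.2.1).
have cnt_f (p : pred nat) m' i : count_mem i [seq j <- iota 0 m' | p j] = ((i < m')%N && p i).
  by rewrite count_uniq_mem ?filter_uniq ?iota_uniq // mem_filter mem_iota andbC.
have term1 t : t \in T1 -> xs (pw r G) (tval t) = xs lR (inner t).
  move=> tin1; have [tin st] := T1T t tin1.
  rewrite /tval /inner !xs_scale -!xs_cat; congr (_ *: _); apply: xs_perm.
  apply: perm_count => i; rewrite pw_cat !count_cat addnCA; congr (_ + _)%N.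
  rewrite count_mono ?filter_uniq ?iota_uniq // mem_filter mem_iota add0n /=.
  rewrite count_pw cnt_f.
  have [iN|iN] := ltnP i n; last first.
    rewrite andbF muln0; apply/count_memPn/negP => /(bndl t i tin).
    by rewrite ltnNge iN.
  have /andP[/hasPn gb _] := goodT t tin.
  have e := sameP t i st iN; move: (e); rewrite {1}/dg /deg.
  case ib: (i \in t.2.1) => er.
    by rewrite (tB t) //= !muln0; apply/count_memPn; apply: gb ib.
  rewrite andbT er /Bs iN /=; case: eqP => [->|_] /=; first by rewrite muln1.
  by rewrite muln0 addn0.
have inner1 t : t \in T1 -> act f (inner t) = t.1 *: yv n' t.2.1.
  move=> tin1; have [tin st] := T1T t tin1.
  rewrite /inner act_scale // act_xs // (act_vb cv) //; last exact: tupT.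
  have -> : map f t.2.1 = t.2.1.
    by rewrite -[RHS]map_id; apply/eq_in_map => i ib; apply: fB; apply: tB ib.
  congr (_ *: _); rewrite map_pw map_cat map_perm_ext ?size_iota //.
  have -> : map f (Bm t) = Bm t.
    rewrite -[RHS]map_id; apply/eq_in_map => i.
    by rewrite mem_filter => /andP[/andP[bi _] _]; apply: fB.
  apply: xs_perm; apply: perm_count => i; rewrite !count_pw count_cat !cnt_f.
  congr (_ * _)%N; case ib: (i \in t.2.1).
    by rewrite (tB t) // !andbF.
  rewrite !andbT; case bi: (Bs i); rewrite ?andbF ?andbT ?addn0 //=.
  by case/andP: bi => iN _; rewrite iN (leq_trans iN nn').
have UG : U (xs (pw r G) (\sum_(t <- T1) tval t)).
  rewrite xs_sum (eq_big_seq _ term1) -xs_sum; apply: subXs => //.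
  by apply: (subA_inv sU ff); rewrite act_sum // (eq_big_seq _ inner1).
(* The remaining terms are fewer, since t0 belongs to T1; multiplied by x_G^r, their sum lies in U'
   and induction applies. *)
pose T2' := [seq (t.1, (t.2.1, pw r G ++ t.2.2)) | t <- T2].
have eT2 : \sum_(t <- T2') tval t = xs (pw r G) (\sum_(t <- T2) tval t).
  by rewrite big_map xs_sum; apply: eq_bigr => t _; rewrite /tval /= xs_cat xs_scale.
have [|||l [ul al hl]] := IH T2' _ _ _ (K + size H)%N.
- rewrite size_map size_filter -ltnS; apply: leq_trans sz.
  rewrite -(count_predC same T) -[X in (X < _)%N]add0n ltn_add2r -has_count.
  by apply/hasP; exists t0 => //; apply/allP.
- by rewrite all_map; apply/allP => t /T2T[/tupT].
- rewrite eT2; apply: (subDl sU' (UU' UG)); rewrite -xs_add -split_T.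
  exact: subXs.
exists (l ++ G); split.
- rewrite cat_uniq ul uG andbT; apply/hasPn => i; rewrite mem_iota => iG /=.
  by apply/negP => /(allP al) /=; lia.
- rewrite all_cat; apply/andP; split; first by apply: sub_all al => i /=; rewrite /K; lia.
  by apply/allP => i /GK /=; rewrite /K; lia.
rewrite pw_cat xs_cat split_T xs_add xs_add; apply: subD => //; first exact: subXs.
by rewrite -eT2.
Qed.

End Reflect.

(** [top_coefs] turns such chains into chains of representations on tuples, and by [tor_terms] a
    step with equal images is negligible. *)
Lemma core_chain_bound : exists L,
  chain_bound (fun U => [/\ is_subobj U, incl P U & incl U (gen P v)])
    (fun U U' => forall u, U' u -> tor r U u) L.
Proof.
have [L hL] := chain_bound_tuples k N N 0; exists L.
apply: (chain_bound_map (phi := top_coefs)) hL.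
- by move=> U [sU _ _]; apply: top_coefs_rep.
- by move=> U U' c; apply: top_coefs_incl.
move=> U U' [sU PU _] [sU' PU' U'v] UU' h u U'u.
have [T tT hT] := gen_terms (U'v u U'u).
rewrite -(subrK (\sum_(t <- T) tval t) u); apply: (subD (tor_subobj r sU)).
  by apply: tor_in; apply: PU.
apply: (tor_terms sU sU' PU UU' _ (leqnn _)) => //.
  by move=> c /h[c' Uc' e]; have -> : c = c' by apply/funext => b; rewrite e.
by rewrite -[X in U' X](subKr u); apply: subB => //; apply: PU'.
Qed.

End CoreBound.

(** * Torsion implies membership in the filtration *)

Section Sufficiency.
Variables (k : fieldType) (s : nat) (M : smooth_mod k s).
Local Notation V := (sm_V M).
Implicit Types (P Q U Z : V -> Prop) (u v w : V).

Section FinLength.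
Variable C : (V -> Prop) -> (V -> Prop) -> Prop.

Lemma fin_length_mod_step P Q : is_subobj P -> is_subobj Q -> incl P Q ->
  C P Q \/ simple_mod C P Q -> fin_length_mod C P Q.
Proof.
move=> sP sQ PQ h; exists 1%N, (fun j => if j is 0%N then P else Q).
by split=> // [[|j] //|[|j] //].
Qed.

Lemma fin_length_mod_trans P Z Q :
  fin_length_mod C P Z -> fin_length_mod C Z Q -> fin_length_mod C P Q.
Proof.
move=> [n [Y [Y0 Yn sY hY]]] [n' [Y' [Y0' Yn' sY' hY']]].
exists (n + n')%N, (fun j => if (j <= n)%N then Y j else Y' (j - n)%N); split.
- by [].
- case: ifP => h; last by rewrite addKn.
  have n0 : n' = 0%N by lia.
  by rewrite n0 addn0 Yn -Yn' n0 Y0'.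
- move=> j hj; case: ifP => h; first exact: sY.
  by apply: sY'; lia.
move=> j hj; case: (ltngtP j n) => h.
- exact: hY.
- rewrite subSn; last exact: ltnW.
  by apply: hY'; lia.
- have -> : Y j = Y' 0%N by rewrite h Yn Y0'.
  by rewrite h subSnn; apply: hY'; lia.
Qed.

Variable r : nat.
Hypothesis torC : forall P Q, is_subobj P -> is_subobj Q -> incl P Q ->
  (forall v, Q v -> tor r P v) -> C P Q.

(** If no Z cuts Q/P into two essential pieces, Q/P is negligible or simple. Otherwise chains in
    either piece can be extended by the other piece as one more essential step, so both have bound L
    and induction applies. *)
Lemma chain_bound_fin_length L P Q : is_subobj P -> is_subobj Q -> incl P Q ->
  chain_bound (fun U => [/\ is_subobj U, incl P U & incl U Q])
    (fun U U' => forall u, U' u -> tor r U u) L ->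
  fin_length_mod C P Q.
Proof.
elim: L P Q => [|L IH] P Q sP sQ PQ hL.
  apply: fin_length_mod_step => //; left; apply: torC => //; apply: contrapT => h.
  suff : (size [:: 0] <= 0)%N by [].
  apply: (hL (fun i => if i is 0%N then P else Q)) => //.
  - by case=> [|i]; split.
  - by case.
  - by move=> i; rewrite inE => /eqP->.
case: (pselect (exists Z, [/\ is_subobj Z, incl P Z, incl Z Q &
    ~ (forall u, Z u -> tor r P u) /\ ~ (forall u, Q u -> tor r Z u)])); last first.
  move=> none; apply: fin_length_mod_step => //.
  case: (pselect (C P Q)) => cPQ; [by left | right; split=> // Z sZ PZ ZQ].
  case: (pselect (forall u, Z u -> tor r P u)) => h1; first by left; apply: torC.
  right; apply: torC => //; apply: contrapT => h2; apply: none.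
  by exists Z.
move=> [Z [sZ PZ ZQ [hP hQ]]]; apply: (@fin_length_mod_trans _ Z); apply: IH => //.
- move=> W CW mW t ut ht.
  (* The chain is cut after a position n beyond t and continued by the essential step up to Q. *)
  pose n := (\max_(i <- t) i).+1.
  pose W' i := if (i <= n)%N then W i else Q.
  have tn i : i \in t -> (i < n)%N by move=> it; rewrite ltnS; apply: leq_max_seq.
  have nt : n \notin t by apply/negP => /tn; rewrite ltnn.
  rewrite -ltnS; apply: (hL W' _ _ (n :: t)).
  + move=> i; rewrite /W'; case: ifP => _; last by split.
    have [sW PW WZ] := CW i.
    by split=> // u /WZ /ZQ.
  + move=> i c; rewrite /W'; case: (ltngtP i n) => // [_|->]; first exact: mW.
    by have [_ _ WZ] := CW n => /WZ /ZQ.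
  + by rewrite /= nt.
  + move=> i; rewrite inE /W' => /orP[/eqP->|it].
      rewrite leqnn ltnn => h; apply: hQ => u /h.
      by apply: tor_incl; case: (CW n).
    by rewrite (tn _ it) (ltnW (tn _ it)); apply: ht.
move=> W CW mW t ut ht.
pose W' i := if i is j.+1 then W j else P.
rewrite -ltnS -(size_map S); apply: (hL W' _ _ (0%N :: map S t)).
- case=> [|i] /=; first by split.
  by have [sW ZW WQ] := CW i; split=> // u /PZ /ZW.
- case=> [|i] c /=; last exact: mW.
  by have [_ ZW _] := CW 0%N => /PZ /ZW.
- rewrite /= map_inj_uniq ?ut ?andbT; last by move=> i j [].
  by apply/negP => /mapP[].
move=> i; rewrite inE => /orP[/eqP-> /= h|/mapP[j jt -> /=]]; last exact: ht.
by apply: hP => u Zu; apply: h; case: (CW 0%N) => _ ZW _; apply: ZW.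
Qed.

End FinLength.

(** By dévissage each [gen P v] has finite length modulo the previous class, so every v of Q lies in
    the sum S and Q/S vanishes. At level 0 the monomial is empty, so torsion means membership in
    P. *)
Lemma tor_InA t P Q : is_subobj P -> is_subobj Q -> incl P Q ->
  (forall v, Q v -> tor t P v) -> InA t P Q.
Proof.
elim: t P Q => [|t IH] P Q sP sQ PQ h.
  move=> v /h /(_ 0%N)[l [_ _]].
  have -> // : pw 0 l = [::] by elim: l.
rewrite /= /loc_fin_length_mod; set S := fun v => _.
have sS : is_subobj S by apply: loc_fin_length_sum_subobj.
apply: (IH S Q) => //; first by move=> u; apply=> // Y [].
move=> v Qv; apply: tor_in => Z sZ hZ; apply: (hZ (gen P v)); last exact: gen_mem.
split; [exact: gen_subobj | exact: gen_incl | exact: gen_min |].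
have {Qv} tv := h v Qv.
apply: (devissage (r := t) (Phi := fun P v => fin_length_mod (InA t) P (gen P v))) tv => //.
- move=> P' u sP' P'u; apply: fin_length_mod_step => //; first exact: gen_subobj.
    exact: gen_incl.
  left; apply: IH => //; [exact: gen_subobj | exact: gen_incl |].
  by move=> w /(gen_min sP' (fun _ => id) P'u); apply: tor_in.
- move=> P' u l sP' h1 h2; set w := xs l u in h1 h2.
  apply: (fin_length_mod_trans h1); apply: (fin_length_mod_trans h2).
  have sw := gen_subobj (gen P' w) u.
  have su := gen_subobj P' u.
  (* The two subobjects have the same elements; a negligible step joins them in the chain. *)
  have inc : incl (gen (gen P' w) u) (gen P' u).
    apply: gen_min => //; apply: gen_min => //; first exact: gen_incl.
    by apply: (subXs su); apply: gen_mem.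
  apply: fin_length_mod_step => //; left; apply: IH => // c hc; apply: tor_in.
  apply: (gen_min sw _ _ hc); last exact: gen_mem.
  by move=> y P'y; do 2!apply: gen_incl.
move=> P' N u sP' cu; have [L hL] := core_chain_bound sP' cu.
apply: (chain_bound_fin_length (r := t) IH) hL => //; first exact: gen_subobj.
exact: gen_incl.
Qed.

Lemma zero_subobj : is_subobj (zero_sub (M := M)).
Proof.
split=> //.
- by move=> u v -> ->; rewrite /zero_sub addr0.
- by move=> a v ->; rewrite /zero_sub scaler0.
- by move=> i v ->; apply: x_zero.
- by move=> f ff v ->; apply: act0.
Qed.

Lemma in_A_top : in_A M s.+1.
Proof.
apply: tor_InA => //; first exact: zero_subobj.
by move=> v _; apply: tor_top; apply: zero_subobj.
Qed.

End Sufficiency.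

(** * A module whose unit is not torsion of level s *)

Section Witness.
Variables (k : fieldType) (s : nat).
Local Notation expo := (nat -> nat).
Local Notation F := (expo -> k^o).

(** A common bound on the variables that occur makes the action smooth; the exponents themselves are
    not bounded. *)
Definition bounded_expo : pred F := fun p =>
  `[< exists B, forall al : expo, p al != 0 -> forall i, (B <= i)%N -> al i = 0%N >].

Lemma bounded_expo_submod : submod_closed bounded_expo.
Proof.
split; first by apply/asboolP; exists 0%N => al; rewrite eqxx.
move=> a p q /asboolP[B hB] /asboolP[B' hB']; apply/asboolP.
exists (B + B')%N => al h i hi.
have [p0|/hB] := eqVneq (p al) 0; last by apply; lia.
apply: hB' => //; last lia.
by move: h; rewrite [X in X != 0](_ : _ = a *: p al + q al) // p0 scaler0 add0r.
Qed.

HB.instance Definition _ := GRing.isSubmodClosed.Build k F bounded_expo bounded_expo_submod.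

Record poly_fun := PolyFun { pf_val : F; _ : bounded_expo pf_val }.
HB.instance Definition _ := [isSub for pf_val].
HB.instance Definition _ := [Choice of poly_fun by <:].
HB.instance Definition _ := [SubChoice_isSubLmodule of poly_fun by <:].

Local Notation pf := poly_fun.

Lemma pf_bound (p : pf) : exists B, forall al : expo, val p al != 0 ->
  forall i, (B <= i)%N -> al i = 0%N.
Proof. by case: p => p bp; apply/asboolP. Qed.

Lemma pf_eq (p q : pf) : (forall al, val p al = val q al) -> p = q.
Proof. by move=> h; apply/val_inj/funext. Qed.

Lemma pf_lin (a : k) (p q : pf) al :
  val (a *: p + q) al = a * val p al + val q al.
Proof. by rewrite linearP. Qed.

Lemma pf_val0 al : val (0 : pf) al = 0.
Proof. by rewrite raddf0. Qed.

Definition lower i (al : expo) : expo := fun j => if j == i then (al j).-1 else al j.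

Definition xfun i (p : F) : F :=
  fun al => if (0 < al i <= s)%N then p (lower i al) else 0.

(* Coefficient functions of polynomials.  As x_i never produces an exponent above s,
   x_i^(s+1) = 0, and the monomial 1 (pf_one below) generates a copy of R/h_s.
   insubd returns 0 on unbounded functions, which arise only for non-finitary f. *)
Definition pf_x i (p : pf) : pf := insubd 0 (xfun i (val p)).
Definition pf_act f (p : pf) : pf := insubd 0 (fun al => val p (al \o f)).

Lemma pf_xE i p al :
  val (pf_x i p) al = if (0 < al i <= s)%N then val p (lower i al) else 0.
Proof.
rewrite insubdK //; apply/asboolP; have [B hB] := pf_bound p.
exists (B + i.+1)%N => be; rewrite /xfun; case: ifP => [_ /hB h j hj|]; last by rewrite eqxx.
by have <- := h j (leq_trans (leq_addr _ _) hj); rewrite /lower ifN //; apply/eqP; lia.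
Qed.

Lemma pf_actE f p al : finitary f -> val (pf_act f p) al = val p (al \o f).
Proof.
move=> [_ [N hN]]; rewrite insubdK //; apply/asboolP; have [B hB] := pf_bound p.
exists (B + N)%N => be /hB h j hj.
by rewrite -(h j) /= ?hN //; lia.
Qed.

Lemma lowerC i j al : lower i (lower j al) = lower j (lower i al).
Proof. by apply/funext => n; rewrite /lower; case: (n == i); case: (n == j). Qed.

(** After n > 0 multiplications, exponents of x_i in the support lie in [n, s], which is empty for n
    = s+1. *)
Lemma pf_x_nil i p : iter s.+1 (pf_x i) p = 0.
Proof.
apply: pf_eq => al; rewrite pf_val0.
suff H n : forall be, val (iter n (pf_x i) p) be != 0 -> (0 < n)%N ->
    (n <= be i <= s)%N.
  by apply/eqP/negPn/negP => /H /(_ isT); lia.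
elim: n => // n IH be /=; rewrite pf_xE; case: ifP => [hb h _|]; last by rewrite eqxx.
case: n IH h => [|n] IH h; first by [].
by have := IH _ h isT; rewrite /lower eqxx; lia.
Qed.

Definition poly_mod : smooth_mod k s.
Proof.
refine (@SMod k s poly_fun pf_x pf_act _ _ pf_x_nil _ _ _ _ _).
- move=> i a u v; apply: pf_eq => al; rewrite pf_lin !pf_xE pf_lin.
  by case: ifP => // _; rewrite mulr0 addr0.
- move=> i j v; apply: pf_eq => al; rewrite !pf_xE lowerC.
  have [->|ij] := eqVneq i j; first by [].
  by rewrite /lower (negbTE ij) eq_sym (negbTE ij); case: ifP; case: ifP.
- move=> f ff a u v; apply: pf_eq => al; rewrite pf_lin !pf_actE // pf_lin //.
- by move=> v; apply: pf_eq => al; rewrite pf_actE //; apply: finitary_id.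
- move=> f g ff gf v; apply: pf_eq => al.
  by rewrite !pf_actE //; apply: finitary_comp.
- move=> f ff i v; apply: pf_eq => al; rewrite pf_actE // !pf_xE /= pf_actE //.
  congr (if _ then val v _ else _); apply/funext => n; rewrite /lower /=.
  by rewrite (inj_eq (finitary_inj ff)).
move=> v; have [B hB] := pf_bound v; exists B => f ff fB.
apply: pf_eq => al; rewrite pf_actE //.
have [h|h] := pselect (forall i, (B <= i)%N -> al i = 0%N).
  congr (val v _); apply/funext => i /=; have [iB|Bi] := ltnP i B; first by rewrite fB.
  by rewrite !h // perm_fix_geq.
have -> : val v al = 0 by apply/eqP/negPn/negP => /hB.
apply/eqP/negPn/negP => /hB h'; apply: h => i iB.
have [g [gf fg gfK]] := finitary_inv ff.
by rewrite -(gfK i) -(h' (g i)) // -(perm_fix_geq _ ff fB) gfK.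
Defined.

Definition pf_one : pf :=
  insubd 0 (fun al => if `[< forall i, al i = 0%N >] then 1 else 0).

Lemma pf_oneE : val pf_one (fun=> 0%N) = 1.
Proof.
rewrite insubdK; first by case: asboolP.
apply/asboolP.
exists 0%N => be; case: asboolP => [h _ i _|_]; first exact: h.
by rewrite eqxx.
Qed.

Lemma xs_one l : (forall i, count_mem i l <= s)%N ->
  val (xs (M := poly_mod) l pf_one : pf) (fun i => count_mem i l) = 1.
Proof.
elim: l => [|i l IH] hl; first exact: pf_oneE.
have hi : (0 < count_mem i (i :: l) <= s)%N by rewrite hl /= eqxx.
rewrite [LHS]pf_xE hi.
rewrite -[RHS]IH; last by move=> j; apply: leq_trans (hl j); rewrite /= leq_addl.
congr (val _ _); apply/funext => j; rewrite /lower.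
by case: (eqVneq j i) => [->|ji] /=; rewrite ?eqxx // eq_sym (negbTE ji).
Qed.

(** Torsion of the unit at level t would make some monomial with exponents at most t <= s vanish,
    but its coefficient at its own exponent is 1. *)
Lemma not_in_A_poly_mod t : (t <= s)%N -> ~ in_A poly_mod t.
Proof.
move=> ts h.
have full : is_subobj (full_sub (M := poly_mod)) by [].
have [l [ul _ hl]] := InA_tor (zero_subobj _) full (fun _ _ => I) h
  (I : full_sub (M := poly_mod) pf_one) 0%N.
have : val (xs (M := poly_mod) (pw t l) pf_one : pf) (fun i => count_mem i (pw t l)) = 1.
  by apply: xs_one => i; rewrite count_pw count_uniq_mem //; case: (_ \in _); lia.
by rewrite hl pf_val0 => /esym/eqP; rewrite oner_eq0.
Qed.

End Witness.

Theorem theorem9p11 (k : fieldType) (s : nat) (hs : (1 <= s)%N) :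
  KGdim_eq k s s.
Proof.
split; first by move=> M; apply: in_A_top.
by move=> t ts; exists (poly_mod k s); apply: not_in_A_poly_mod.
Qed.
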